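(* Let $\mathfrak{X}$ be the relative $\mathrm{SL}(3,\mathbb{C})$-character variety of the three-holed sphere $S_{3,0}$. Then there exists a Poisson bracket $\{\cdot,\cdot\}$ on $\mathbb{C}[\mathfrak{X}]$ for which the generators $t_{(\pm i)}$, $1\le i\le3$, are Casimirs, and which is completely determined by the formulae $$\{t_{(4)},t_{(-4)}\}=P-2t_{(5)},$$ $$\{t_{(\pm4)},t_{(5)}\}=\frac{t_{(5)}\{t_{(\pm4)},P\}-\{t_{(\pm4)},Q\}}{\{t_{(-4)},t_{(4)}\}}.$$
   Context: Let $G=\mathrm{SL}(3,\mathbb{C})$. $S_{3,0}$ is the sphere with three open disks removed; its fundamental group is presented as $\langle\mathtt{x}_1,\mathtt{x}_2,\mathtt{x}_3\mid\mathtt{x}_3\mathtt{x}_2\mathtt{x}_1=1\rangle$ with $\mathtt{x}_1,\mathtt{x}_2,\mathtt{x}_3$ the boundary curves, so it is free on $\mathtt{x}_1,\mathtt{x}_2$. $\mathfrak{X}=\mathrm{Hom}(\pi_1(S_{3,0}),G)/\!\!/G\cong G^{\times2}/\!\!/G$ is the affine variety with coordinate ring $\mathbb{C}[\mathfrak{X}]=\mathbb{C}[G\times G]^G$ (invariants under simultaneous conjugation); ''relative'' means that it is considered together with the map $\mathfrak{X}\to(G/\!\!/G)^3$ that restricts representation classes to the three boundary curves. With $\mathbf{x}_1,\mathbf{x}_2$ the coordinate matrices, put $t_{(1)}=\mathrm{tr}(\mathbf{x}_1)$, $t_{(-1)}=\mathrm{tr}(\mathbf{x}_1^{-1})$, $t_{(2)}=\mathrm{tr}(\mathbf{x}_2)$,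 $t_{(-2)}=\mathrm{tr}(\mathbf{x}_2^{-1})$, $t_{(3)}=\mathrm{tr}(\mathbf{x}_1\mathbf{x}_2)$, $t_{(-3)}=\mathrm{tr}(\mathbf{x}_1^{-1}\mathbf{x}_2^{-1})$, $t_{(4)}=\mathrm{tr}(\mathbf{x}_1\mathbf{x}_2^{-1})$, $t_{(-4)}=\mathrm{tr}(\mathbf{x}_1^{-1}\mathbf{x}_2)$, $t_{(5)}=\mathrm{tr}(\mathbf{x}_1\mathbf{x}_2\mathbf{x}_1^{-1}\mathbf{x}_2^{-1})$. These nine elements generate $\mathbb{C}[\mathfrak{X}]$, which is the quotient of the polynomial ring in them by the single relation $t_{(5)}^2-Pt_{(5)}+Q=0$, where $$\begin{aligned}P=&\,t_{(1)}t_{(-1)}t_{(2)}t_{(-2)}-t_{(1)}t_{(2)}t_{(-3)}-t_{(-1)}t_{(-2)}t_{(3)}-t_{(1)}t_{(-2)}t_{(-4)}-t_{(-1)}t_{(2)}t_{(4)}\\&+t_{(1)}t_{(-1)}+t_{(2)}t_{(-2)}+t_{(3)}t_{(-3)}+t_{(4)}t_{(-4)}-3,\end{aligned}$$ $$\begin{aligned} Q=&\,9-6t_{(1)}t_{(-1)}-6t_{(2)}t_{(-2)}-6t_{(3)}t_{(-3)}-6t_{(4)}t_{(-4)}+t_{(1)}^3+t_{(2)}^3+t_{(3)}^3+t_{(4)}^3\\ &+t_{(-1)}^3+t_{(-2)}^3+t_{(-3)}^3+t_{(-4)}^3-3t_{(-4)}t_{(-3)}t_{(-1)}-3t_{(4)}t_{(3)}t_{(1)}\\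 &-3t_{(-4)}t_{(2)}t_{(3)}-3t_{(4)}t_{(-2)}t_{(-3)}+3t_{(-4)}t_{(-2)}t_{(1)}+3t_{(4)}t_{(2)}t_{(-1)}\\ &+3t_{(1)}t_{(2)}t_{(-3)}+3t_{(-1)}t_{(-2)}t_{(3)}+t_{(-2)}t_{(-1)}t_{(2)}t_{(1)}+t_{(-3)}t_{(-2)}t_{(3)}t_{(2)}\\ &+t_{(-4)}t_{(-1)}t_{(4)}t_{(1)}+t_{(-4)}t_{(-2)}t_{(4)}t_{(2)}+t_{(-3)}t_{(-1)}t_{(3)}t_{(1)}+t_{(-3)}t_{(-4)}t_{(3)}t_{(4)}\\ &+t_{(-4)}^2t_{(-3)}t_{(-2)}+t_{(4)}^2t_{(3)}t_{(2)}+t_{(-1)}^2t_{(-2)}t_{(-4)}+t_{(1)}^2t_{(2)}t_{(4)}\\ &+t_{(1)}t_{(-2)}^2t_{(-3)}+t_{(-1)}t_{(2)}^2t_{(3)}+t_{(-4)}t_{(-3)}t_{(1)}^2+t_{(4)}t_{(3)}t_{(-1)}^2\\ &+t_{(-4)}t_{(2)}t_{(-3)}^2+t_{(4)}t_{(-2)}t_{(3)}^2+t_{(-1)}^2t_{(-3)}t_{(2)}+t_{(1)}^2t_{(3)}t_{(-2)}\\ &+t_{(-4)}t_{(1)}t_{(2)}^2+t_{(4)}t_{(-1)}t_{(-2)}^2+t_{(-4)}t_{(3)}t_{(-2)}^2+t_{(4)}t_{(-3)}t_{(2)}^2\\ &+t_{(1)}t_{(3)}t_{(-4)}^2+t_{(-1)}t_{(-3)}t_{(4)}^2+t_{(-1)}t_{(-4)}t_{(3)}^2+t_{(1)}t_{(4)}t_{(-3)}^2-2t_{(-3)}^2t_{(-2)}t_{(-1)}\\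 &-2t_{(3)}^2t_{(2)}t_{(1)}-2t_{(-4)}^2t_{(-1)}t_{(2)}-2t_{(4)}^2t_{(1)}t_{(-2)}+t_{(-1)}^2t_{(-2)}^2t_{(-3)}+t_{(1)}^2t_{(2)}^2t_{(3)}\\ &+t_{(-4)}t_{(-1)}^2t_{(2)}^2+t_{(4)}t_{(1)}^2t_{(-2)}^2-t_{(-4)}t_{(-2)}^2t_{(2)}t_{(1)}-t_{(4)}t_{(2)}^2t_{(-2)}t_{(-1)}\\ &-t_{(-3)}t_{(1)}^2t_{(-1)}t_{(2)}-t_{(3)}t_{(-1)}^2t_{(1)}t_{(-2)}-t_{(-3)}t_{(2)}^2t_{(-2)}t_{(1)}-t_{(3)}t_{(-2)}^2t_{(2)}t_{(-1)}\\ &-t_{(-4)}t_{(-2)}t_{(-1)}t_{(1)}^2-t_{(4)}t_{(2)}t_{(1)}t_{(-1)}^2-t_{(-1)}t_{(-2)}^3t_{(1)}-t_{(-1)}t_{(2)}^3t_{(1)}\\ &-t_{(-1)}^3t_{(-2)}t_{(2)}-t_{(1)}^3t_{(-2)}t_{(2)}-t_{(-4)}t_{(-3)}t_{(-2)}t_{(-1)}t_{(2)}-t_{(4)}t_{(3)}t_{(2)}t_{(1)}t_{(-2)}\\ &-t_{(-1)}t_{(1)}t_{(2)}t_{(-4)}t_{(3)}-t_{(-1)}t_{(1)}t_{(-2)}t_{(4)}t_{(-3)}+t_{(-2)}t_{(-1)}^2t_{(1)}^2t_{(2)}+t_{(-1)}t_{(-2)}^2t_{(2)}^2t_{(1)}.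 \end{aligned}$$ A Poisson bracket on a commutative $\mathbb{C}$-algebra is a Lie bracket that is a derivation in each argument; a Casimir is an element whose bracket with every element is $0$. The quotient in the second formula is taken in the fraction field of the domain $\mathbb{C}[\mathfrak{X}]$; the brackets $\{t_{(\pm4)},P\}$ and $\{t_{(\pm4)},Q\}$ are evaluated from the first formula and the Casimir condition using the derivation property. *)

(* Defs.v *)
From HB Require Import structures.
From mathcomp Require Import all_boot all_order all_algebra fraction complex.
From mathcomp Require Import boolp classical_sets functions reals.
From mathcomp Require Import -(notations) mpoly.
From mathcomp Require Import perm ring.

Set Implicit Arguments.
Unset Strict Implicit.
Unset Printing Implicit Defensive.

Import GRing.Theory.
Local Open Scope ring_scope.

Section Poisson.
Variables (K : fieldType) (A : comAlgType K).
Implicit Type br : A -> A -> A.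

Definition lie_bracket br : Prop :=
  [/\ forall (a : K) u v w, br (a *: u + v) w = a *: br u w + br v w,
      forall (a : K) u v w, br w (a *: u + v) = a *: br w u + br w v,
      forall u, br u u = 0
    & forall u v w, br u (br v w) + br v (br w u) + br w (br u v) = 0].

Definition poisson_bracket br : Prop :=
  [/\ lie_bracket br,
      forall u v w, br (u * v) w = u * br v w + br u w * v
    & forall u v w, br w (u * v) = u * br w v + br w u * v].

Definition casimir br (c : A) : Prop := forall u, br c u = 0.

End Poisson.

Section CoordinateRing.
Variable K : closedFieldType.

Definition SL3 : Type := {A : 'M[K]_3 | \det A == 1}.
HB.instance Definition _ :=
  SubEquality.copy SL3 {A : 'M[K]_3 | \det A == 1}.

Lemma SL3_det (g : SL3) : \det (val g) = 1.
Proof. exact/eqP/(valP g). Qed.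

Lemma SL3_unit (g : SL3) : val g \in unitmx.
Proof. by rewrite unitmxE SL3_det unitr1. Qed.

Lemma SL3_conj_det (g A : SL3) :
  \det (val g *m val A *m invmx (val g)) == 1.
Proof. by rewrite !det_mulmx det_inv !SL3_det invr1 !mulr1. Qed.

Definition SL3_conj (g A : SL3) : SL3 :=
  Sub (val g *m val A *m invmx (val g)) (SL3_conj_det g A).

Definition coords (x : SL3 * SL3) : 'I_(3 * 3 + 3 * 3) -> K :=
  row_mx (mxvec (val x.1)) (mxvec (val x.2)) 0.

(* G x G is a closed subvariety of affine 18-space over the algebraically
   closed field K, so K[G x G] is the ring of restrictions of polynomials in
   the 18 matrix entries. *)
Definition regular_fun (f : SL3 * SL3 -> K) : Prop :=
  exists p : mpoly (3 * 3 + 3 * 3) K, forall x, f x = meval (coords x) p.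

Definition conj_invariant (f : SL3 * SL3 -> K) : Prop :=
  forall g x, f (SL3_conj g x.1, SL3_conj g x.2) = f x.

Definition inv_regular : {pred SL3 * SL3 -> K} :=
  fun f => `[< regular_fun f /\ conj_invariant f >].

Lemma inv_regularP f :
  reflect (regular_fun f /\ conj_invariant f) (f \in inv_regular).
Proof. exact: asboolP. Qed.

(* K[G x G]^G, the coordinate ring of (G x G)//G. *)
Record coord_ring := CoordRing {
  cr_fun :> SL3 * SL3 -> K;
  cr_funP : cr_fun \in inv_regular }.

HB.instance Definition _ := [isSub for cr_fun].
HB.instance Definition _ := [Choice of coord_ring by <:].

Lemma regular_cst c : regular_fun (fun=> c).
Proof. by exists (mpolyC _ c) => x; rewrite mevalC. Qed.

Lemma regularD f g :
  regular_fun f -> regular_fun g -> regular_fun (fun x => f x + g x).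
Proof. by move=> [p Hp] [q Hq]; exists (p + q) => x; rewrite mevalD Hp Hq. Qed.

Lemma regularM f g :
  regular_fun f -> regular_fun g -> regular_fun (fun x => f x * g x).
Proof. by move=> [p Hp] [q Hq]; exists (p * q) => x; rewrite mevalM Hp Hq. Qed.

Lemma regularN f : regular_fun f -> regular_fun (fun x => - f x).
Proof. by move=> [p Hp]; exists (- p) => x; rewrite mevalN Hp. Qed.

Lemma regular_sum (I : Type) (r : seq I) (P : pred I) (F : I -> SL3 * SL3 -> K) :
  (forall i, P i -> regular_fun (F i)) ->
  regular_fun (fun x => \sum_(i <- r | P i) F i x).
Proof.
move=> HF; elim: r => [|i r IH].
  have -> : (fun x => \sum_(i <- [::] | P i) F i x) = fun=> 0.
    by apply/funext => x; rewrite big_nil.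
  exact: regular_cst.
have [Pi|nPi] := boolP (P i); last first.
  suff -> : (fun x => \sum_(j <- i :: r | P j) F j x) =
            fun x => \sum_(j <- r | P j) F j x by [].
  by apply/funext => x; rewrite big_cons (negPf nPi).
have -> : (fun x => \sum_(j <- i :: r | P j) F j x) =
          fun x => F i x + \sum_(j <- r | P j) F j x.
  by apply/funext => x; rewrite big_cons Pi.
by apply: regularD => //; apply: HF.
Qed.

Lemma inv_regular_subring : subring_closed inv_regular.
Proof.
split.
- by apply/inv_regularP; split=> //; apply: regular_cst.
- move=> f g /inv_regularP[rf cf] /inv_regularP[rg cg].
  apply/inv_regularP; split; first exact/regularD/regularN.
  by move=> h x; rewrite /= /GRing.add /= /GRing.opp /= cf cg.
- move=> f g /inv_regularP[rf cf] /inv_regularP[rg cg].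
  apply/inv_regularP; split; first exact: regularM.
  by move=> h x; rewrite /GRing.mul /= cf cg.
Qed.

HB.instance Definition _ := GRing.isSubringClosed.Build (SL3 * SL3 -> K)
  inv_regular inv_regular_subring.
HB.instance Definition _ := GRing.SubChoice_isSubComPzRing.Build
  (SL3 * SL3 -> K) inv_regular coord_ring inv_regular_subring.

Lemma crP (f g : coord_ring) : (forall x, f x = g x) -> f = g.
Proof. by move=> fg; apply/val_inj/funext. Qed.

Lemma crD (f g : coord_ring) x : (f + g) x = f x + g x.
Proof. by []. Qed.

Lemma crM (f g : coord_ring) x : (f * g) x = f x * g x.
Proof. by []. Qed.

Lemma cr0 x : (0 : coord_ring) x = 0.
Proof. by []. Qed.

Lemma cr1 x : (1 : coord_ring) x = 1.
Proof. by []. Qed.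

Definition SL3_one : SL3 := Sub 1%:M (introT eqP (det1 K 3)).

Lemma coord_ring_nonzero : (1 : coord_ring) != 0.
Proof.
apply/eqP => /(congr1 (fun f : coord_ring => f (SL3_one, SL3_one))).
by rewrite cr1 cr0 => /eqP; rewrite oner_eq0.
Qed.

HB.instance Definition _ :=
  GRing.PzSemiRing_isNonZero.Build coord_ring coord_ring_nonzero.

Lemma scale_subproof (a : K) (f : coord_ring) :
  (fun x => a * f x) \in inv_regular.
Proof.
case/inv_regularP: (cr_funP f) => rf cf; apply/inv_regularP; split.
  exact/regularM/rf/regular_cst.
by move=> g x; rewrite cf.
Qed.

Definition cr_scale (a : K) (f : coord_ring) : coord_ring :=
  CoordRing (scale_subproof a f).

Lemma cr_scaleA a b f : cr_scale a (cr_scale b f) = cr_scale (a * b) f.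
Proof. by apply/crP => x; apply: mulrA. Qed.

Lemma cr_scale1 : left_id 1 cr_scale.
Proof. by move=> f; apply/crP => x; apply: mul1r. Qed.

Lemma cr_scaleDr : right_distributive cr_scale +%R.
Proof. by move=> a f g; apply/crP => x; apply: mulrDr. Qed.

Lemma cr_scaleDl f : {morph cr_scale^~ f : a b / a + b}.
Proof. by move=> a b; apply/crP => x; apply: mulrDl. Qed.

HB.instance Definition _ := GRing.Zmodule_isLmodule.Build K coord_ring
  cr_scaleA cr_scale1 cr_scaleDr cr_scaleDl.

Lemma crZ (a : K) (f : coord_ring) x : (a *: f) x = a * f x.
Proof. by []. Qed.

Lemma cr_scaleAl (a : K) (f g : coord_ring) : a *: (f * g) = a *: f * g.
Proof. by apply/crP => x; rewrite crZ !crM crZ mulrA. Qed.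

HB.instance Definition _ :=
  GRing.Lmodule_isLalgebra.Build K coord_ring cr_scaleAl.

Lemma cr_scaleAr (a : K) (f g : coord_ring) : a *: (f * g) = f * (a *: g).
Proof. by apply/crP => x; rewrite crZ !crM crZ mulrCA. Qed.

HB.instance Definition _ :=
  GRing.Lalgebra_isAlgebra.Build K coord_ring cr_scaleAr.

Definition cr_unit : pred coord_ring := fun f => `[< exists g, g * f = 1 >].

Definition cr_inv (f : coord_ring) : coord_ring :=
  if pselect (exists g, g * f = 1) is left ex then projT1 (cid ex) else f.

Lemma cr_mulVf : {in cr_unit, left_inverse 1 cr_inv *%R}.
Proof.
move=> f /asboolP ex; rewrite /cr_inv; case: pselect => // ex'.
exact: (projT2 (cid ex')).
Qed.

Lemma cr_unitP f g : g * f = 1 -> cr_unit f.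
Proof. by move=> fg; apply/asboolP; exists g. Qed.

Lemma cr_inv0 : {in [predC cr_unit], cr_inv =1 id}.
Proof.
by move=> f /asboolP nex; rewrite /cr_inv; case: pselect.
Qed.

HB.instance Definition _ :=
  GRing.ComNzRing_hasMulInverse.Build coord_ring cr_mulVf cr_unitP cr_inv0.

(* The ring is a domain because any two points A, B of SL3 lie on the rational
   curve obtained from the segment (1 - t) A + t B by dividing its last column
   by the determinant. *)

Definition ratl (d : {poly K}) (h : K -> K) : Prop :=
  exists (N : nat) (r : {poly K}),
    forall t, d.[t] != 0 -> h t * d.[t] ^+ N = r.[t].

Lemma ratl_poly d (r : {poly K}) : ratl d (fun t => r.[t]).
Proof. by exists 0%N, r => t _; rewrite expr0 mulr1. Qed.

Lemma ratlD d h k : ratl d h -> ratl d k -> ratl d (fun t => h t + k t).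
Proof.
move=> [N [r Hr]] [N' [r' Hr']].
exists (N + N')%N, (r * d ^+ N' + r' * d ^+ N) => t dt.
by rewrite hornerD !hornerM !horner_exp -Hr // -Hr' // exprD; ring.
Qed.

Lemma ratlM d h k : ratl d h -> ratl d k -> ratl d (fun t => h t * k t).
Proof.
move=> [N [r Hr]] [N' [r' Hr']].
exists (N + N')%N, (r * r') => t dt.
by rewrite hornerM -Hr // -Hr' // exprD; ring.
Qed.

Lemma ratl_ext d h k :
  (forall t, d.[t] != 0 -> h t = k t) -> ratl d h -> ratl d k.
Proof. by move=> e [N [r Hr]]; exists N, r => t dt; rewrite -e ?Hr. Qed.

Lemma ratl_inv d d1 d2 : d = d1 * d2 -> ratl d (fun t => d1.[t]^-1).
Proof.
move=> ->; exists 1%N, d2 => t; rewrite hornerM mulf_eq0 negb_or => /andP[h _].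
by rewrite expr1 mulKf.
Qed.

Lemma ratl_meval d n (v : K -> 'I_n -> K) (p : mpoly n K) :
  (forall i, ratl d (fun t => v t i)) -> ratl d (fun t => meval (v t) p).
Proof.
move=> Hv.
have Hx i k : ratl d (fun t => v t i ^+ k).
  elim: k => [|k IH].
    apply: (ratl_ext _ (ratl_poly d 1)) => t _.
    by rewrite expr0 hornerC.
  apply: (ratl_ext _ (ratlM (Hv i) IH)) => t _.
  by rewrite exprS.
have Hprod (m : multinom n) (r : seq 'I_n) :
    ratl d (fun t => \prod_(i <- r) v t i ^+ m i).
  elim: r => [|i r IH].
    apply: (ratl_ext _ (ratl_poly d 1)) => t _.
    by rewrite big_nil hornerC.
  apply: (ratl_ext _ (ratlM (Hx i (m i)) IH)) => t _.
  by rewrite big_cons.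
have Hsum (r : seq (multinom n)) :
    ratl d (fun t => \sum_(m <- r) mcoeff m p * \prod_i v t i ^+ m i).
  elim: r => [|m r IH].
    apply: (ratl_ext _ (ratl_poly d 0)) => t _.
    by rewrite big_nil horner0.
  apply: (ratl_ext _ (ratlD
    (ratlM (ratl_poly d (mcoeff m p)%:P) (Hprod m _)) IH)) => t _.
  by rewrite big_cons hornerC.
by apply: ratl_ext (Hsum _) => t _; rewrite mevalE.
Qed.

Section Curve.
Variables A B : SL3.

Let seg : 'M[{poly K}]_3 :=
  map_mx polyC (val A) + 'X *: map_mx polyC (val B - val A).

Definition seg_det : {poly K} := \det seg.

Let corr (t : K) : 'rV[K]_3 :=
  \row_j (if j == ord_max then seg_det.[t]^-1 else 1).

Let seg_at (t : K) : 'M[K]_3 := map_mx (horner_eval t) seg.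

Definition curve_mx (t : K) : 'M[K]_3 := seg_at t *m diag_mx (corr t).

Definition curve (t : K) : SL3 := insubd SL3_one (curve_mx t).

Let seg_atE t : seg_at t = val A + t *: (val B - val A).
Proof.
by apply/matrixP => i j; rewrite !mxE /horner_eval !hornerE /= mulrC.
Qed.

Let seg_detE t : seg_det.[t] = \det (seg_at t).
Proof. by rewrite -horner_evalE /seg_at det_map_mx. Qed.

Lemma seg_det_at0 : seg_det.[0] = 1.
Proof. by rewrite seg_detE seg_atE scale0r addr0 SL3_det. Qed.

Lemma seg_det_at1 : seg_det.[1] = 1.
Proof. by rewrite seg_detE seg_atE scale1r addrC subrK SL3_det. Qed.

Lemma curveE t : seg_det.[t] != 0 -> val (curve t) = curve_mx t.
Proof.
move=> dt; rewrite /curve val_insubd; case: ifPn => // /negP[].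
rewrite /curve_mx det_mulmx det_diag -seg_detE big_ord_recr /=.
rewrite big1 => [|i _]; last first.
  by rewrite mxE -val_eqE /= ltn_eqF.
by rewrite mxE eqxx mul1r divff.
Qed.

Let corr1 t : seg_det.[t] = 1 -> diag_mx (corr t) = 1%:M.
Proof.
move=> dt; apply/matrixP => i j; rewrite !mxE dt invr1.
by case: ifP.
Qed.

Lemma curve0 : curve 0 = A.
Proof.
apply: val_inj; rewrite curveE ?seg_det_at0 ?oner_eq0 //.
by rewrite /curve_mx corr1 ?seg_det_at0 // mulmx1 seg_atE scale0r addr0.
Qed.

Lemma curve1 : curve 1 = B.
Proof.
apply: val_inj; rewrite curveE ?seg_det_at1 ?oner_eq0 //.
by rewrite /curve_mx corr1 ?seg_det_at1 // mulmx1 seg_atE scale1r addrC subrK.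
Qed.

Lemma curve_ratl d d2 i j : d = seg_det * d2 ->
  ratl d (fun t => val (curve t) i j).
Proof.
move=> dE.
have H : ratl d (fun t => seg_at t i j * corr t 0 j).
  apply: ratlM.
    apply: (ratl_ext _ (ratl_poly d (seg i j))) => t _.
    by rewrite [RHS]mxE.
  case: (eqVneq j ord_max) => [->|jm].
    by apply: (ratl_ext _ (ratl_inv dE)) => t _; rewrite mxE eqxx.
  apply: (ratl_ext _ (ratl_poly d 1)) => t _.
  by rewrite mxE (negPf jm) hornerC.
apply: (ratl_ext _ H) => t; rewrite dE hornerM mulf_eq0 negb_or => /andP[dt _].
by rewrite curveE // /curve_mx mul_mx_diag [RHS]mxE.
Qed.

End Curve.

Lemma regular_curve (f : SL3 * SL3 -> K) (x y : SL3 * SL3) :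
  regular_fun f ->
  ratl (seg_det x.1 y.1 * seg_det x.2 y.2)
    (fun t => f (curve x.1 y.1 t, curve x.2 y.2 t)).
Proof.
move=> [p Hp].
set d := (X in ratl X _).
suff H i : ratl d (fun t => coords (curve x.1 y.1 t, curve x.2 y.2 t) i).
  by apply: (ratl_ext _ (ratl_meval p H)) => t _; rewrite Hp.
rewrite /coords /=; case: (split_ordP i) => k ->.
  case/mxvec_indexP: k => a b.
  apply: (ratl_ext _ (curve_ratl a b (erefl d))) => t _.
  by rewrite row_mxEl mxvecE.
case/mxvec_indexP: k => a b.
apply: (ratl_ext _ (curve_ratl a b (mulrC _ _ : d = _))) => t _.
by rewrite row_mxEr mxvecE.
Qed.

Lemma coord_ring_domain : GRing.integral_domain_axiom coord_ring.
Proof.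
move=> f g fg0; have [//|] := boolP ((f == 0) || (g == 0)).
rewrite negb_or => /andP[f0 g0].
have nz (h : coord_ring) : h != 0 -> exists x, h x != 0.
  move=> /eqP h0; apply: contrapT => nex; apply: h0; apply: crP => x.
  have [->//|hx] := eqVneq (h x) 0.
  by case: nex; exists x.
have [x fx] := nz _ f0; have [y gy] := nz _ g0.
have [rf _] := inv_regularP _ (cr_funP f).
have [rg _] := inv_regularP _ (cr_funP g).
have [N [r Hr]] := regular_curve x y rf.
have [N' [r' Hr']] := regular_curve x y rg.
set d := seg_det x.1 y.1 * seg_det x.2 y.2 in Hr Hr'.
have d0 : d.[0] = 1 by rewrite hornerM !seg_det_at0 mulr1.
have d1 : d.[1] = 1 by rewrite hornerM !seg_det_at1 mulr1.
have xE : (curve x.1 y.1 0, curve x.2 y.2 0) = x.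
  by rewrite !curve0; case: (x).
have yE : (curve x.1 y.1 1, curve x.2 y.2 1) = y.
  by rewrite !curve1; case: (y).
have rN0 : r != 0.
  apply/eqP => r0; have := Hr 0; rewrite d0 oner_eq0 => /(_ isT).
  rewrite expr1n mulr1 xE r0 horner0 => /eqP.
  by rewrite (negPf fx).
have r'N0 : r' != 0.
  apply/eqP => r0; have := Hr' 1; rewrite d1 oner_eq0 => /(_ isT).
  rewrite expr1n mulr1 yE r0 horner0 => /eqP.
  by rewrite (negPf gy).
have dN0 : d != 0.
  by apply/eqP => dz; move: d0; rewrite dz horner0 => /eqP; rewrite eq_sym oner_eq0.
clearbody d.
have /closed_nonrootP[t] : d * (r * r') != 0 by rewrite !mulf_neq0.
rewrite /root !hornerM !mulf_eq0 !negb_or => /andP[dt /andP[rt r't]].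
move: rt r't; rewrite -Hr // -Hr' //.
rewrite !mulf_eq0 !negb_or => /andP[ft _] /andP[gt _].
move: (congr1 (fun h : coord_ring =>
  h (curve x.1 y.1 t, curve x.2 y.2 t)) fg0).
rewrite crM cr0 => /eqP.
by rewrite mulf_eq0 (negPf ft) (negPf gt).
Qed.

HB.instance Definition _ :=
  GRing.ComUnitRing_isIntegral.Build coord_ring coord_ring_domain.

(* tk is t_(k) and tkn is t_(-k). *)

Definition reg_equivariant (h : SL3 * SL3 -> 'M[K]_3) : Prop :=
  (forall i j, regular_fun (fun x => h x i j)) /\
  (forall g x, h (SL3_conj g x.1, SL3_conj g x.2) =
               val g *m h x *m invmx (val g)).

Definition X1 (x : SL3 * SL3) : 'M[K]_3 := val x.1.
Definition X2 (x : SL3 * SL3) : 'M[K]_3 := val x.2.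

Lemma reg_equivariant_X1 : reg_equivariant X1.
Proof.
split=> // i j; exists (mpolyX K (mnm1 (lshift (3 * 3) (mxvec_index i j)))) => x.
by rewrite mevalXU /coords row_mxEl mxvecE.
Qed.

Lemma reg_equivariant_X2 : reg_equivariant X2.
Proof.
split=> // i j; exists (mpolyX K (mnm1 (rshift (3 * 3) (mxvec_index i j)))) => x.
by rewrite mevalXU /coords row_mxEr mxvecE.
Qed.

Lemma reg_equivariantM h k : reg_equivariant h -> reg_equivariant k ->
  reg_equivariant (fun x => h x *m k x).
Proof.
move=> [rh ch] [rk ck]; split=> [i j|g x].
  have -> : (fun x => (h x *m k x) i j) = fun x => \sum_l h x i l * k x l j.
    by apply/funext => x; rewrite mxE.
  by apply: regular_sum => l _; apply: regularM.
by rewrite ch ck !mulmxA mulmxKV ?SL3_unit.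
Qed.

Lemma regular_prod (I : Type) (r : seq I) (F : I -> SL3 * SL3 -> K) :
  (forall i, regular_fun (F i)) -> regular_fun (fun x => \prod_(i <- r) F i x).
Proof.
move=> HF; elim: r => [|i r IH].
  have -> : (fun x => \prod_(i <- [::]) F i x) = fun=> 1.
    by apply/funext => x; rewrite big_nil.
  exact: regular_cst.
have -> : (fun x => \prod_(j <- i :: r) F j x) =
          fun x => F i x * \prod_(j <- r) F j x.
  by apply/funext => x; rewrite big_cons.
exact: regularM.
Qed.

Lemma reg_equivariantV h : (forall x, \det (h x) = 1) ->
  reg_equivariant h -> reg_equivariant (fun x => invmx (h x)).
Proof.
move=> dh [rh ch]; have uh x : h x \in unitmx by rewrite unitmxE dh unitr1.
split=> [i j|g x].
  have -> : (fun x => invmx (h x) i j) = fun x => (-1) ^+ (j + i) *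
      \sum_(s : 'S_2) (-1) ^+ s * \prod_l h x (lift j l) (lift i (s l)).
    apply/funext => x; rewrite /invmx uh dh invr1 scale1r mxE /cofactor.
    congr (_ * _); apply: eq_bigr => s _; congr (_ * _).
    by apply: eq_bigr => l _; rewrite !mxE.
  apply: regularM; first exact: regular_cst.
  apply: regular_sum => s _; apply: regularM; first exact: regular_cst.
  by apply: regular_prod => l.
have ug := SL3_unit g; rewrite ch; set G := val g in ug *.
have uM : G *m h x *m invmx G \in unitmx by rewrite -ch.
apply: (can_inj (mulKmx uM)); rewrite mulmxV // !mulmxA mulmxKV // mulmxK //.
by rewrite mulmxV.
Qed.

Lemma tr_inv_regular h :
  reg_equivariant h -> (fun x => \tr (h x)) \in inv_regular.
Proof.
move=> [rh ch]; apply/inv_regularP; split=> [|g x].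
  by apply: regular_sum => i _.
by rewrite ch mxtrace_mulC mulmxA mulVmx ?mul1mx ?SL3_unit.
Qed.

Let re1 := reg_equivariant_X1.
Let re2 := reg_equivariant_X2.
Let re1n := reg_equivariantV (fun x => SL3_det x.1) re1.
Let re2n := reg_equivariantV (fun x => SL3_det x.2) re2.
Let reM := reg_equivariantM.

Lemma t1_inv : (fun x => \tr (X1 x)) \in inv_regular.
Proof. exact: tr_inv_regular re1. Qed.
Definition t1 : coord_ring := CoordRing t1_inv.

Lemma t1n_inv : (fun x => \tr (invmx (X1 x))) \in inv_regular.
Proof. exact: tr_inv_regular re1n. Qed.
Definition t1n : coord_ring := CoordRing t1n_inv.

Lemma t2_inv : (fun x => \tr (X2 x)) \in inv_regular.
Proof. exact: tr_inv_regular re2. Qed.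
Definition t2 : coord_ring := CoordRing t2_inv.

Lemma t2n_inv : (fun x => \tr (invmx (X2 x))) \in inv_regular.
Proof. exact: tr_inv_regular re2n. Qed.
Definition t2n : coord_ring := CoordRing t2n_inv.

Lemma t3_inv : (fun x => \tr (X1 x *m X2 x)) \in inv_regular.
Proof. exact: tr_inv_regular (reM re1 re2). Qed.
Definition t3 : coord_ring := CoordRing t3_inv.

Lemma t3n_inv : (fun x => \tr (invmx (X1 x) *m invmx (X2 x))) \in inv_regular.
Proof. exact: tr_inv_regular (reM re1n re2n). Qed.
Definition t3n : coord_ring := CoordRing t3n_inv.

Lemma t4_inv : (fun x => \tr (X1 x *m invmx (X2 x))) \in inv_regular.
Proof. exact: tr_inv_regular (reM re1 re2n). Qed.
Definition t4 : coord_ring := CoordRing t4_inv.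

Lemma t4n_inv : (fun x => \tr (invmx (X1 x) *m X2 x)) \in inv_regular.
Proof. exact: tr_inv_regular (reM re1n re2). Qed.
Definition t4n : coord_ring := CoordRing t4n_inv.

Lemma t5_inv :
  (fun x => \tr (X1 x *m X2 x *m invmx (X1 x) *m invmx (X2 x))) \in inv_regular.
Proof. exact: tr_inv_regular (reM (reM (reM re1 re2) re1n) re2n). Qed.
Definition t5 : coord_ring := CoordRing t5_inv.

(* P and Q are the sum and the product of the two roots in the defining relation
   t_(5)^2 - P t_(5) + Q = 0 of the coordinate ring. *)
Definition polP : coord_ring :=
  t1 * t1n * t2 * t2n - t1 * t2 * t3n - t1n * t2n * t3 - t1 * t2n * t4n
  - t1n * t2 * t4 + t1 * t1n + t2 * t2n + t3 * t3n + t4 * t4n - 3.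

Definition polQ : coord_ring :=
  9 - 6 * t1 * t1n - 6 * t2 * t2n - 6 * t3 * t3n - 6 * t4 * t4n + t1 ^+ 3
  + t2 ^+ 3 + t3 ^+ 3 + t4 ^+ 3
  + t1n ^+ 3 + t2n ^+ 3 + t3n ^+ 3 + t4n ^+ 3 - 3 * t4n * t3n * t1n
  - 3 * t4 * t3 * t1
  - 3 * t4n * t2 * t3 - 3 * t4 * t2n * t3n + 3 * t4n * t2n * t1
  + 3 * t4 * t2 * t1n
  + 3 * t1 * t2 * t3n + 3 * t1n * t2n * t3 + t2n * t1n * t2 * t1
  + t3n * t2n * t3 * t2
  + t4n * t1n * t4 * t1 + t4n * t2n * t4 * t2 + t3n * t1n * t3 * t1
  + t3n * t4n * t3 * t4
  + t4n ^+ 2 * t3n * t2n + t4 ^+ 2 * t3 * t2 + t1n ^+ 2 * t2n * t4n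
  + t1 ^+ 2 * t2 * t4
  + t1 * t2n ^+ 2 * t3n + t1n * t2 ^+ 2 * t3 + t4n * t3n * t1 ^+ 2
  + t4 * t3 * t1n ^+ 2
  + t4n * t2 * t3n ^+ 2 + t4 * t2n * t3 ^+ 2 + t1n ^+ 2 * t3n * t2
  + t1 ^+ 2 * t3 * t2n
  + t4n * t1 * t2 ^+ 2 + t4 * t1n * t2n ^+ 2 + t4n * t3 * t2n ^+ 2
  + t4 * t3n * t2 ^+ 2
  + t1 * t3 * t4n ^+ 2 + t1n * t3n * t4 ^+ 2 + t1n * t4n * t3 ^+ 2
  + t1 * t4 * t3n ^+ 2 - 2 * t3n ^+ 2 * t2n * t1n
  - 2 * t3 ^+ 2 * t2 * t1 - 2 * t4n ^+ 2 * t1n * t2 - 2 * t4 ^+ 2 * t1 * t2n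
  + t1n ^+ 2 * t2n ^+ 2 * t3n + t1 ^+ 2 * t2 ^+ 2 * t3
  + t4n * t1n ^+ 2 * t2 ^+ 2 + t4 * t1 ^+ 2 * t2n ^+ 2
  - t4n * t2n ^+ 2 * t2 * t1 - t4 * t2 ^+ 2 * t2n * t1n
  - t3n * t1 ^+ 2 * t1n * t2 - t3 * t1n ^+ 2 * t1 * t2n
  - t3n * t2 ^+ 2 * t2n * t1 - t3 * t2n ^+ 2 * t2 * t1n
  - t4n * t2n * t1n * t1 ^+ 2 - t4 * t2 * t1 * t1n ^+ 2
  - t1n * t2n ^+ 3 * t1 - t1n * t2 ^+ 3 * t1
  - t1n ^+ 3 * t2n * t2 - t1 ^+ 3 * t2n * t2 - t4n * t3n * t2n * t1n * t2
  - t4 * t3 * t2 * t1 * t2n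
  - t1n * t1 * t2 * t4n * t3 - t1n * t1 * t2n * t4 * t3n
  + t2n * t1n ^+ 2 * t1 ^+ 2 * t2 + t1n * t2n ^+ 2 * t2 ^+ 2 * t1.

End CoordinateRing.

Arguments t1 {K}.
Arguments t1n {K}.
Arguments t2 {K}.
Arguments t2n {K}.
Arguments t3 {K}.
Arguments t3n {K}.
Arguments t4 {K}.
Arguments t4n {K}.
Arguments t5 {K}.
Arguments polP {K}.
Arguments polQ {K}.

(* Main.v *)
Require Import Defs.
From HB Require Import structures.
From mathcomp Require Import all_boot all_order all_algebra fraction complex.
From mathcomp Require Import boolp reals.
From mathcomp Require Import -(notations) mpoly.
From mathcomp Require Import ring.

Set Implicit Arguments.
Unset Strict Implicit.
Unset Printing Implicit Defensive.

Import GRing.Theory Num.Theory.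
Local Open Scope ring_scope.

(** Write X1, X2 for the two matrices and A for the ring of invariants.  The
    proof has two independent halves, and neither needs a list of generators
    of A.

    Rigidity.  A derivation of A that annihilates the eight traces t_(1),
    t_(-1), ..., t_(4), t_(-4) is zero ([derivation_rigidity]).  The ninth
    trace t_(5) is a root of T^2 - P T + Q, whose other root is the trace of
    the inverse commutator, so it is annihilated too.  Now let l be an
    eigenvalue of X1 with right and left eigenvectors e and w.  In the basis
    e, X2 e, X2^-1 e the entries of X1 and X2 are quotients of traces of words
    in X1 and X2 weighted by polynomials in l, and every trace of a word that
    occurs is a polynomial in the nine traces.  Evaluating an invariant f on
    this normal form gives f d = F, where d is a power of a Gram determinant
    and d and F are both of the form s0 + s1 l + s2 l^2 with annihilated
    coefficients.  Since this holds for all three roots l of a cubic that is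
    generically separable, coefficients may be compared: f is a quotient of
    annihilated elements of A, hence is annihilated.

    Rigidity gives uniqueness at once: the difference of two solutions is a
    biderivation that vanishes on all pairs of the eight traces
    ([biderivation_eq0]).  For the same reason the Jacobi identity holds for
    every skew biderivation for which the six boundary traces are Casimirs:
    only t_(4) and t_(-4) remain, and among three arguments chosen from them
    two coincide ([jacobi]).

    Existence.  If G1, G2 are the gradients of f and H1, H2 those of g with
    respect to the two matrices, put
      {f, g} = - 1/2 (tr (X1^2 [G1, H1]) + tr (X2^2 [G2, H2])).
    This is the quasi-Poisson (Goldman) bracket of the three-holed sphere,
    restricted to invariants.  Gradients of functions on SL(3) x SL(3) are
    defined modulo multiples of X1^-1 and X2^-1, which does not affect the
    formula, so the bracket makes sense on all of A and its values are again
    regular and invariant.  The traces of X1 and X2 and of their inverses are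
    Casimirs because their gradients commute with X1^2 and X2^2; the two
    traces of X1 X2 and of X1^-1 X2^-1 are Casimirs because
    [X1, G1] + [X2, G2] = 0 for an invariant ([infinitesimal_invariance]).
    The value on t_(4), t_(-4) is the difference of the two commutator traces.
    Finally the formula for the bracket with t_(5) is what one gets by
    bracketing with the quadratic relation of t_(5), because
    2 t_(5) - P is not zero in the domain A ([comm_gap_neq0]). *)

(** * Explicit formulas for matrices of order three *)

Section Matrix3.
Variable K : comUnitRingType.
Implicit Types A B : 'M[K]_3.

Lemma ord3P (P : 'I_3 -> Prop) : P 0 -> P 1 -> P 2 -> forall i, P i.
Proof.
move=> P0 P1 P2 [[|[|[|//]]] lt_i3].
- by have -> : Ordinal lt_i3 = 0 by exact/val_inj.
- by have -> : Ordinal lt_i3 = 1 by exact/val_inj.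
- by have -> : Ordinal lt_i3 = 2 by exact/val_inj.
Qed.

Lemma sum3E (V : nmodType) (F : 'I_3 -> V) :
  \sum_i F i = F 0 + F 1 + F 2.
Proof.
rewrite !big_ord_recl big_ord0 addr0 addrA.
by congr (F _ + F _ + F _); apply: val_inj.
Qed.

Lemma ord3D :
  ((0 + 1 = 1 :> 'I_3)%R * (0 + 2 = 2 :> 'I_3)%R * (1 + 1 = 2 :> 'I_3)%R *
   (1 + 2 = 0 :> 'I_3)%R * (2 + 1 = 0 :> 'I_3)%R * (2 + 2 = 1 :> 'I_3)%R)%type.
Proof. by do !split; apply: val_inj. Qed.

(** The adjugate matrix; the indices run modulo 3, which absorbs the signs of the
    cofactors. *)
Definition adj3 A : 'M[K]_3 := \matrix_(i, j)
  (A (j + 1) (i + 1) * A (j + 2) (i + 2) - A (j + 1) (i + 2) * A (j + 2) (i + 1)).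

Lemma det2E (A : 'M[K]_2) : \det A = A 0 0 * A 1 1 - A 0 1 * A 1 0.
Proof.
rewrite (expand_det_row _ 0) 2!big_ord_recl big_ord0 /cofactor !det_mx11 !mxE.
have l0 (j : 'I_1) : lift (0 : 'I_2) j = 1 by rewrite ord1; apply: val_inj.
have l1 (j : 'I_1) : lift (1 : 'I_2) j = 0 by rewrite ord1; apply: val_inj.
by rewrite !l0 !l1 /=; ring.
Qed.

Lemma det3E A : \det A =
  A 0 0 * (A 1 1 * A 2 2 - A 1 2 * A 2 1)
  - A 0 1 * (A 1 0 * A 2 2 - A 1 2 * A 2 0)
  + A 0 2 * (A 1 0 * A 2 1 - A 1 1 * A 2 0).
Proof.
rewrite (expand_det_row _ 0) sum3E /cofactor.
have l00 : lift (0 : 'I_3) (0 : 'I_2) = 1 by exact: val_inj.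
have l01 : lift (0 : 'I_3) (1 : 'I_2) = 2 by exact: val_inj.
have l10 : lift (1 : 'I_3) (0 : 'I_2) = 0 by exact: val_inj.
have l11 : lift (1 : 'I_3) (1 : 'I_2) = 2 by exact: val_inj.
have l20 : lift (2 : 'I_3) (0 : 'I_2) = 0 by exact: val_inj.
have l21 : lift (2 : 'I_3) (1 : 'I_2) = 1 by exact: val_inj.
by rewrite !det2E !mxE !l00 !l01 !l10 !l11 !l20 !l21 /=; ring.
Qed.

Lemma mul_adj3 A : A *m adj3 A = (\det A)%:M.
Proof.
apply/matrixP; elim/ord3P; elim/ord3P;
  by rewrite !mxE sum3E !mxE !ord3D det3E /= ?mulr1n ?mulr0n; ring.
Qed.

Lemma invmx3 A : \det A = 1 -> invmx A = adj3 A.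
Proof.
move=> dA; have uA : A \in unitmx by rewrite unitmxE dA unitr1.
by apply: (can_inj (mulKmx uA)); rewrite mulmxV // mul_adj3 dA.
Qed.

Lemma tr3E A : \tr A = A 0 0 + A 1 1 + A 2 2.
Proof. exact: sum3E. Qed.

Lemma det_charp3 A (l : K) : \det A = 1 ->
  \det (l%:M - A) = l ^+ 3 - \tr A * l ^+ 2 + \tr (invmx A) * l - 1.
Proof.
move=> dA; rewrite (invmx3 dA) -[in RHS]dA !tr3E !det3E !mxE !ord3D /=.
by rewrite ?mulr1n ?mulr0n; ring.
Qed.

End Matrix3.

(** * Diagonal representatives of generic orbits *)

Section Conjugation.
Variable K : closedFieldType.
Implicit Types (f : coord_ring K) (x y : SL3 K * SL3 K) (A B : SL3 K).

Lemma coord_ring_conj f (g : SL3 K) x :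
  f (SL3_conj g x.1, SL3_conj g x.2) = f x.
Proof. by have [_ ->] := inv_regularP _ (cr_funP f). Qed.

Lemma det_scale_unit n (P : 'M[K]_n.+1) : P \in unitmx ->
  exists2 c, c != 0 & \det (c *: P) = 1.
Proof.
rewrite unitmxE unitfE => dP.
have [c cE] := @solve_monicpoly K n.+1
  (fun i => if i == 0%N then (\det P)^-1 else 0) isT.
have {}cE : c ^+ n.+1 = (\det P)^-1.
  by rewrite cE big_ord_recl /= expr0 mulr1 big1 ?addr0 // => i _; rewrite mul0r.
exists c; last by rewrite detZ cE mulVf.
apply: contraTneq dP => c0; move/esym/eqP: cE.
by rewrite c0 expr0n invr_eq0 => ->.
Qed.

(** Scalars act trivially, so invariance extends from SL to GL. *)
Lemma coord_ring_GLconj f (P : 'M[K]_3) x y : P \in unitmx ->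
  P *m val x.1 = val y.1 *m P -> P *m val x.2 = val y.2 *m P -> f x = f y.
Proof.
move=> uP e1 e2; have [c c0 /eqP dcP] := det_scale_unit uP.
pose g : SL3 K := Sub (c *: P) dcP.
rewrite -(coord_ring_conj f g x); congr (f _); case: y e1 e2 => y1 y2 /= e1 e2.
by congr (_, _); apply: val_inj; rewrite /= -scalemxAl (e1, e2) scalemxAr
  mulmxK // -[c *: P]/(val g) SL3_unit.
Qed.

Definition char_cubic (x : SL3 K * SL3 K) (l : K) : K :=
  l ^+ 3 - t1 x * l ^+ 2 + t1n x * l - 1.

Definition disc : coord_ring K :=
  t1 ^+ 2 * t1n ^+ 2 - 4 * t1 ^+ 3 - 4 * t1n ^+ 3 + 18 * t1 * t1n - 27.

Lemma crX f n x : (f ^+ n) x = f x ^+ n.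
Proof. by elim: n => [|n IH]; rewrite ?exprS ?crM ?IH. Qed.

Lemma crN f x : (- f) x = - f x. Proof. by []. Qed.

Lemma crn n x : (n%:R : coord_ring K) x = n%:R.
Proof. by elim: n => [|n IH]; rewrite ?mulrS ?crD ?IH. Qed.

Definition crE := (crD, crM, crN, crX, crn, cr0, cr1).

Lemma charpE x l : char_cubic x l = \det (l%:M - val x.1).
Proof. by rewrite det_charp3 // SL3_det. Qed.

Lemma horner_char_poly n (A : 'M[K]_n) l : (char_poly A).[l] = \det (l%:M - A).
Proof.
rewrite -horner_evalE -det_map_mx; congr (\det _); apply/matrixP => i j.
by rewrite !mxE /= horner_evalE !hornerE hornerMn hornerX.
Qed.

Lemma charp_roots x : exists l m n, [/\ l * m * n = 1,
  t1 x = l + m + n, t1n x = m * n + l * n + l * m &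
  char_poly (val x.1) = ('X - l%:P) * ('X - m%:P) * ('X - n%:P)].
Proof.
set p := char_poly _; have monp : p \is monic := char_poly_monic _.
have [r pE] := closed_field_poly_normal p.
have szp : size p = 4 by rewrite size_char_poly.
move: pE; rewrite (monicP monp) scale1r => pE.
move: szp; rewrite pE size_prod_XsubC => -[]; case: r pE => [|l [|m [|n []]]] //.
rewrite !big_cons big_nil mulr1 mulrA => pE _.
exists l, m, n.
have val_p t : t ^+ 3 - t1 x * t ^+ 2 + t1n x * t - 1 = (t - l) * (t - m) * (t - n).
  rewrite -[LHS]/(char_cubic x t) charpE -horner_char_poly -/p pE.
  by rewrite !hornerM !hornerXsubC.
have e1 : l * m * n = 1.
  have -> : l * m * n = - ((0 - l) * (0 - m) * (0 - n)) by ring.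
  by rewrite -val_p; ring.
have t1E : t1 x = l + m + n.
  apply: oppr_inj; rewrite -[LHS](@char_poly_trace _ 3 (val x.1)) // -/p pE.
  rewrite (_ : _ * _ * _ = \prod_(z <- [:: l; m; n]) ('X - z%:P)).
    by rewrite coefPn_prod_XsubC //= !big_cons big_nil addr0 addrA.
  by rewrite !big_cons big_nil mulr1 mulrA.
split=> //; have := val_p 1; rewrite t1E => h.
apply/eqP; rewrite -subr_eq0; apply/eqP.
transitivity (1 ^+ 3 - (l + m + n) * 1 ^+ 2 + t1n x * 1 - 1
   - (1 - l) * (1 - m) * (1 - n)); first by ring: e1.
by rewrite h subrr.
Qed.

Lemma disc_roots x l m n : l * m * n = 1 ->
  t1 x = l + m + n -> t1n x = m * n + l * n + l * m ->
  disc x = ((l - m) * (m - n) * (n - l)) ^+ 2.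
Proof. by move=> e s1 s2; rewrite /disc !crE s1 s2; ring: e. Qed.

(** Where the discriminant of X1 does not vanish, each invariant can be computed
    at a pair whose first matrix is diagonal. *)
Lemma diagonalize x : disc x != 0 -> exists y d,
  val y.1 = diag_mx d /\ forall f, f x = f y.
Proof.
have [l [m [n [e1 s1 s2 pE]]]] := charp_roots x.
rewrite (disc_roots e1 s1 s2) sqrf_eq0 !mulf_eq0 !subr_eq0 !negb_or.
case/andP=> /andP[ne1 ne2] ne3.
have /diagonalizableP[P uP /diagonalizable_forPex[d /(simmxP uP) dE]] :
    exists2 rs, uniq rs & mxminpoly (val x.1) %| \prod_(z <- rs) ('X - z%:P).
  exists [:: l; m; n]; first by rewrite /= !inE negb_or ne1 eq_sym ne3 ne2.
  by rewrite !big_cons big_nil mulr1 mulrA -pE mxminpoly_dvd_char.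
have det_conj (A : SL3 K) : \det (P *m val A *m invmx P) == 1.
  rewrite !det_mulmx mulrAC -det_mulmx mulmxV // det1 mul1r.
  exact: (valP A).
pose cj A : SL3 K := Sub (P *m val A *m invmx P) (det_conj A).
exists (cj x.1, cj x.2), d; split=> [|f] /=.
  by rewrite dE mulmxK.
by apply: (coord_ring_GLconj f uP); rewrite /= mulmxKV.
Qed.

Lemma t5n_inv : (fun x => \tr (X2 x *m X1 x *m invmx (X2 x) *m invmx (X1 x)))
  \in @inv_regular K.
Proof.
have re1 := @reg_equivariant_X1 K; have re2 := @reg_equivariant_X2 K.
have re1n := reg_equivariantV (fun x => SL3_det x.1) re1.
have re2n := reg_equivariantV (fun x => SL3_det x.2) re2.
by apply: tr_inv_regular; do !apply: reg_equivariantM.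
Qed.

(** The trace of the inverse commutator, the second root of the quadratic
    relation of t_(5). *)
Definition t5n : coord_ring K := CoordRing t5n_inv.

Lemma adj3_diag (d : 'rV[K]_3) :
  adj3 (diag_mx d) = diag_mx (\row_j (d 0 (j + 1) * d 0 (j + 2))).
Proof.
apply/matrixP; elim/ord3P; elim/ord3P;
  by rewrite !mxE !ord3D /= ?mulr1n ?mulr0n; ring.
Qed.

(** When X1 is diagonal, invariants depend on X2 only through the products of its
    entries along cycles: the diagonal entries a, b, c, the products p, q, r along
    2-cycles and the products u, v along the two 3-cycles.  The first eight traces
    involve neither u nor v, and exchanging u and v, that is, transposing X2,
    exchanges the two commutator traces. *)
Section DiagonalFirst.
Variables (y : SL3 K * SL3 K) (d : 'rV[K]_3).
Hypothesis y1E : val y.1 = diag_mx d.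

Notation l := (d 0 0).
Notation m := (d 0 1).
Notation n := (d 0 2).
Notation X := (val y.2).
Notation a := (X 0 0).
Notation b := (X 1 1).
Notation c := (X 2 2).
Notation p := (X 0 1 * X 1 0).
Notation q := (X 0 2 * X 2 0).
Notation r := (X 1 2 * X 2 1).
Notation u := (X 0 1 * X 1 2 * X 2 0).
Notation v := (X 0 2 * X 2 1 * X 1 0).
(* As l m n = 1, these are l/m + m/n + n/l and m/l + n/m + l/n. *)
Notation w := (l ^+ 2 * n + m ^+ 2 * l + n ^+ 2 * m).
Notation w' := (m ^+ 2 * n + n ^+ 2 * l + l ^+ 2 * m).
Notation s0 := (a * (b * c - r) + b * (a * c - q) + c * (a * b - p)
  - c * p * (l ^+ 2 * n + m ^+ 2 * n) - b * q * (l ^+ 2 * m + n ^+ 2 * m)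
  - a * r * (m ^+ 2 * l + n ^+ 2 * l)).

Lemma diag_prod : l * m * n = 1.
Proof. by rewrite -(SL3_det y.1) y1E det3E !mxE /=; ring. Qed.

Lemma diag_tracesE :
  (t1 y = l + m + n) * (t1n y = m * n + l * n + l * m) *
  (t2 y = a + b + c) * (t2n y = (b * c - r) + (a * c - q) + (a * b - p)) *
  (t3 y = l * a + m * b + n * c) *
  (t3n y = m * n * (b * c - r) + l * n * (a * c - q) + l * m * (a * b - p)) *
  (t4 y = l * (b * c - r) + m * (a * c - q) + n * (a * b - p)) *
  (t4n y = m * n * a + l * n * b + l * m * c).
Proof.
rewrite /t1 /t1n /t2 /t2n /t3 /t3n /t4 /t4n /= /X1 /X2.
rewrite !invmx3 ?SL3_det // y1E adj3_diag !mul_diag_mx !tr3E !mxE !ord3D /=.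
by do !split; ring.
Qed.

Lemma diag_commE : (t5 y = s0 + w * u + w' * v) * (t5n y = s0 + w' * u + w * v).
Proof.
rewrite /t5 /t5n /= /X1 /X2 !invmx3 ?SL3_det // y1E adj3_diag.
have trE (e f : 'rV[K]_3) (A B : 'M[K]_3) :
    \tr (diag_mx e *m A *m diag_mx f *m B)
    = \sum_i \sum_j e 0 i * A i j * f 0 j * B j i.
  apply: eq_bigr => i _; rewrite mxE; apply: eq_bigr => j _.
  by rewrite mul_mx_diag mul_diag_mx !mxE.
by split; rewrite 1?[\tr (X *m _ *m _ *m _)]mxtrace_mulC ?mulmxA trE !sum3E !mxE !ord3D;
  move: diag_prod => e1; ring: e1.
Qed.

Lemma diag_uv : u + v = 1 - a * b * c + a * r + b * q + c * p.
Proof.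
have := SL3_det y.2; rewrite det3E => dX.
by apply/eqP; rewrite -subr_eq0 -(subrr 1) -[X in _ == X - _]dX; apply/eqP; ring.
Qed.

Lemma polP_diag : polP y = t5 y + t5n y.
Proof.
rewrite !diag_commE.
transitivity (2 * s0 + (w + w') * (u + v)); last by ring.
rewrite diag_uv /polP !crE !diag_tracesE.
move: diag_prod; move: (d 0 0) (d 0 1) (d 0 2) => l' m' n' e1.
move: a b c p q r => a' b' c' p' q' r'.
by ring: e1.
Qed.

(** The product of the commutator traces is symmetric in u and v, and
    u v = p q r, so det X2 = 1 eliminates u and v. *)
Lemma polQ_diag : polQ y = t5 y * t5n y.
Proof.
rewrite !diag_commE.
(* The two factors are s0 + w u + w' v and s0 + w' u + w v. *)
transitivity (s0 ^+ 2 + s0 * (w + w') * (u + v) + w * w' * (u + v) ^+ 2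
  + (w - w') ^+ 2 * (p * q * r)); last by ring.
rewrite diag_uv /polQ !crE !diag_tracesE.
move: diag_prod; move: (d 0 0) (d 0 1) (d 0 2) => l' m' n' e1.
move: a b c p q r => a' b' c' p' q' r'.
by ring: e1.
Qed.

End DiagonalFirst.

End Conjugation.



Arguments disc {K}.
Arguments t5n {K}.

(** * Identities valid on a dense set of pairs *)

Section Sample.
Variable K : closedFieldType.
Hypothesis char_gt3 : 6 != 0 :> K.

Lemma two_neq0 : 2 != 0 :> K.
Proof.
by apply: contraNneq char_gt3 => e; rewrite -[6]/((2 * 3)%:R) natrM e mul0r.
Qed.

Lemma three_neq0 : 3 != 0 :> K.
Proof.
by apply: contraNneq char_gt3 => e; rewrite -[6]/((2 * 3)%:R) natrM e mulr0.
Qed.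

Lemma four_neq0 : 4 != 0 :> K.
Proof. by rewrite -[4]/((2 * 2)%:R) natrM mulf_neq0 ?two_neq0. Qed.

Definition sample_eig : 'rV[K]_3 := \row_i nth 0 [:: 1; 2; 2^-1] i.

Lemma sample1_det : \det (diag_mx sample_eig) == 1.
Proof. by rewrite det3E !mxE /=; apply/eqP; field; exact: two_neq0. Qed.

Lemma sample2_det : \det (\matrix_(i, j) (j == i + 1)%:R : 'M[K]_3) == 1.
Proof. by rewrite det3E !mxE /=; apply/eqP; ring. Qed.

(** A pair at which everything required of a generic pair can be checked: X1 has
    distinct eigenvalues and X2 is a cyclic permutation matrix, so that all cycle
    products of X2 but one vanish. *)
Definition sample : SL3 K * SL3 K :=
  (Sub (diag_mx sample_eig) sample1_det, Sub (\matrix_(i, j) (j == i + 1)%:R) sample2_det).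

Lemma disc_neq0 : disc != 0 :> coord_ring K.
Proof.
apply: contraNneq three_neq0 => d0.
have : disc sample = 0 by rewrite d0.
have e1 : val sample.1 = diag_mx sample_eig by [].
rewrite (disc_roots (diag_prod e1)) ?(diag_tracesE e1) // !mxE /= => /eqP.
have -> : ((1 - 2) * (2 - 2^-1) * (2^-1 - 1)) ^+ 2 = (3 / 4) ^+ 2 :> K.
  by field; rewrite four_neq0 two_neq0.
by rewrite sqrf_eq0 mulf_eq0 invr_eq0 (negPf four_neq0) orbF.
Qed.

(** The ring of invariants is a domain, so an identity may be checked where the
    discriminant is not zero. *)
Lemma disc_dense (f g : coord_ring K) :
  (forall x, disc x != 0 -> f x = g x) -> f = g.
Proof.
move=> fg; apply/eqP; rewrite -subr_eq0.
suff /eqP : disc * (f - g) = 0 by rewrite mulf_eq0 (negPf disc_neq0).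
apply: crP => x; rewrite crM crD crN cr0.
by have [->|/fg->] := eqVneq (disc x) 0; rewrite ?mul0r // subrr mulr0.
Qed.

Lemma comm_sum : polP = t5 + t5n :> coord_ring K.
Proof.
apply: disc_dense => x /diagonalize[y [d [y1E fxy]]].
by rewrite crD !fxy (polP_diag y1E).
Qed.

Lemma comm_prod : polQ = t5 * t5n :> coord_ring K.
Proof.
apply: disc_dense => x /diagonalize[y [d [y1E fxy]]].
by rewrite crM !fxy (polQ_diag y1E).
Qed.

Lemma t5_quadratic : t5 ^+ 2 - polP * t5 + polQ = 0 :> coord_ring K.
Proof. by rewrite comm_sum comm_prod; ring. Qed.

(** The left-hand side is the difference of the two commutator traces, which is
    3/4 at the sample pair. *)
Lemma comm_gap_neq0 : 2 * t5 - polP != 0 :> coord_ring K.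
Proof.
rewrite comm_sum; apply: contraNneq three_neq0 => d0.
have : (2 * t5 - (t5 + t5n)) sample = 0 by rewrite d0.
have e1 : val sample.1 = diag_mx sample_eig by [].
rewrite !crE !(diag_commE e1) !mxE /= => /(congr1 (fun z => 4 * z)).
rewrite [RHS]mulr0 => <-; by apply/eqP; field; rewrite ?four_neq0 two_neq0.
Qed.

End Sample.

(** * Trace identities from the Cayley-Hamilton theorem *)

Section CayleyHamilton3.
Variable K : comUnitRingType.
Implicit Types A B : 'M[K]_3.

Lemma adj3_charmx A (l : K) : \det A = 1 ->
  adj3 (l%:M - A) = invmx A + l *: A + (l ^+ 2 - \tr A * l)%:M.
Proof.
move=> dA; rewrite (invmx3 dA); apply/matrixP; elim/ord3P; elim/ord3P;
  by rewrite !mxE !ord3D tr3E /= ?mulr1n ?mulr0n; ring.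
Qed.

Lemma sqr_mx3 A : \det A = 1 ->
  A *m A = \tr A *: A - (\tr (invmx A))%:M + invmx A.
Proof.
move=> dA; rewrite (invmx3 dA); apply/matrixP; elim/ord3P; elim/ord3P;
  by rewrite !mxE sum3E !tr3E !mxE !ord3D /= ?mulr1n ?mulr0n; ring.
Qed.

Lemma tr_mul_sqr (Z A : 'M[K]_3) : \det A = 1 ->
  \tr (Z *m (A *m A)) =
    \tr A * \tr (Z *m A) - \tr (invmx A) * \tr Z + \tr (Z *m invmx A).
Proof.
move=> dA; rewrite sqr_mx3 // mulmxDr mulmxBr -scalemxAr mul_mx_scalar.
by rewrite linearD linearB !linearZ.
Qed.

Lemma tr_sqr A : \det A = 1 ->
  \tr (A *m A) = \tr A ^+ 2 - 2 * \tr (invmx A).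
Proof.
move=> dA; rewrite -[A *m A]mul1mx tr_mul_sqr // !mul1mx mxtrace1; ring.
Qed.

Section TwoMatrices.
Variables A B : 'M[K]_3.
Hypotheses (dA : \det A = 1) (dB : \det B = 1).
Let uA : A \in unitmx. Proof. by rewrite unitmxE dA unitr1. Qed.
Let uB : B \in unitmx. Proof. by rewrite unitmxE dB unitr1. Qed.
Let dAB : \det (A *m B) = 1. Proof. by rewrite det_mulmx dA dB mulr1. Qed.
Let dBV : \det (invmx B) = 1. Proof. by rewrite det_inv dB invr1. Qed.

Lemma invmxM : invmx (A *m B) = invmx B *m invmx A.
Proof.
have uAB : A *m B \in unitmx by rewrite unitmx_mul uA.
apply: (can_inj (mulKmx uAB)); rewrite mulmxV // -mulmxA (mulmxA B) mulmxV //.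
by rewrite mul1mx mulmxV.
Qed.

Lemma tr_ABAB :
  \tr (A *m B *m A *m B) = \tr (A *m B) ^+ 2 - 2 * \tr (invmx A *m invmx B).
Proof. by rewrite -mulmxA tr_sqr // invmxM (mxtrace_mulC (invmx B)). Qed.

(** Since A B A B^-1 = (A B)^2 B^-2, Cayley-Hamilton for A B and for B^-1 reduces
    this trace to traces of words of length at most two. *)
Lemma tr_ABAV : \tr (A *m B *m A *m invmx B) =
  \tr (A *m B) * \tr (A *m invmx B) + \tr B * \tr (invmx A *m invmx B)
  - \tr B * \tr (invmx B) * \tr (invmx A) + \tr (invmx B) * \tr (invmx A *m B)
  + \tr (invmx A).
Proof.
set V := invmx B; set U := invmx A.
have BV : B *m V = 1%:M by rewrite mulmxV.
have -> : A *m B *m A *m V = (A *m B) *m (A *m B) *m (V *m V).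
  by rewrite -!mulmxA (mulmxA B V) BV mul1mx.
rewrite mxtrace_mulC tr_mul_sqr // invmxM -/U -/V.
rewrite (tr_sqr dBV) invmxK (mxtrace_mulC (V *m V) (A *m B)).
rewrite -[A *m B *m (V *m V)]mulmxA (mulmxA B) BV mul1mx.
rewrite (mxtrace_mulC (V *m V)) tr_mul_sqr // invmxK.
rewrite (mxtrace_mulC (V *m U) V) mulmxA.
rewrite (mxtrace_mulC (V *m V)) tr_mul_sqr // invmxK.
rewrite (mxtrace_mulC (V *m U) B) mulmxA BV mul1mx (mxtrace_mulC V U).
rewrite -/V; ring.
Qed.
End TwoMatrices.
End CayleyHamilton3.

(** * Eigenprojections as adjugates *)

Section RankOne.
Variable K : fieldType.
Implicit Types B : 'M[K]_3.

(** Jacobi's identity for the minors of order two of an adjugate matrix. *)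
Lemma adj3_minor B (i j : 'I_3) :
  adj3 B i j * adj3 B (i + 1) (j + 1) - adj3 B i (j + 1) * adj3 B (i + 1) j
  = \det B * B (j + 2) (i + 2).
Proof.
move: i j; elim/ord3P; elim/ord3P; rewrite det3E !mxE !ord3D; ring.
Qed.

Lemma ord3_cases (i k : 'I_3) : [\/ k = i, k = i + 1 | i = k + 1].
Proof.
move: i k; elim/ord3P; elim/ord3P; rewrite ?ord3D; by constructor.
Qed.

Lemma adj3_singular B (i j k l : 'I_3) : \det B = 0 ->
  adj3 B i j * adj3 B k l = adj3 B i l * adj3 B k j.
Proof.
move=> dB.
have base a b : adj3 B a b * adj3 B (a + 1) (b + 1) = adj3 B a (b + 1) * adj3 B (a + 1) b.
  by apply/eqP; rewrite -subr_eq0 adj3_minor dB mul0r.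
have [->|->|->] := ord3_cases i k; have [->|->|->] := ord3_cases j l => //;
  by [exact: mulrC | rewrite base | rewrite mulrC -base mulrC
     | rewrite mulrC base mulrC].
Qed.

(** For B = l - X1 with l an eigenvalue, u and w are a right and a left
    eigenvector of X1. *)
Lemma adj3_rank1 B : \det B = 0 ->
  exists (u : 'cV_3) (w : 'rV_3), adj3 B = u *m w.
Proof.
move=> dB; have [->|] := eqVneq (adj3 B) 0.
  by exists 0, 0; rewrite mul0mx.
case/matrix0Pn=> a [b eab]; 
exists (\col_i adj3 B i b), (\row_j (adj3 B a j / adj3 B a b)).
apply/matrixP => i j; rewrite [RHS]mxE big_ord1 [X in _ = X * _]mxE [X in _ = _ * X]mxE.
by rewrite mulrA (adj3_singular i b a j dB) mulfK.
Qed.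

Lemma quadratic_3roots (a b c x y z : K) : x != y -> y != z -> z != x ->
  a + b * x + c * x ^+ 2 = 0 -> a + b * y + c * y ^+ 2 = 0 ->
  a + b * z + c * z ^+ 2 = 0 -> [/\ a = 0, b = 0 & c = 0].
Proof.
rewrite -subr_eq0 => xy; rewrite -subr_eq0 => yz; rewrite -subr_eq0 => zx ex ey ez.
have bxy : b + c * (x + y) = 0.
  apply: (mulfI xy); rewrite mulr0 -[RHS](subrr 0) -[in X in _ = X - _]ex -ey; ring.
have byz : b + c * (y + z) = 0.
  apply: (mulfI yz); rewrite mulr0 -[RHS](subrr 0) -[in X in _ = X - _]ey -ez; ring.
have c0 : c = 0.
  apply: (mulfI zx); rewrite mulr0 -[RHS](subrr 0) -[in X in _ = X - _]byz -bxy; ring.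
move: bxy ex; rewrite c0 !mul0r !addr0 => b0; rewrite b0 mul0r addr0 => a0.
by [].
Qed.
End RankOne.

(** * Derivations that annihilate the eight trace coordinates *)

Section Rigidity.
Variable K : closedFieldType.
Hypothesis char_gt3 : 6 != 0 :> K.
Local Notation A := (coord_ring K).
Local Notation pt := (SL3 K * SL3 K)%type.

Definition derivation (D : A -> A) : Prop :=
  (forall (a : K) f g, D (a *: f + g) = a *: D f + D g) /\
  (forall f g, D (f * g) = f * D g + D f * g).

Variable D : A -> A.
Hypothesis derD : derivation D.

Lemma derD_add f g : D (f + g) = D f + D g.
Proof. by rewrite -[f]scale1r derD.1 !scale1r. Qed.

Lemma derD0 : D 0 = 0.
Proof. by apply: (addrI (D 0)); rewrite -derD_add !addr0. Qed.

Lemma derDZ a f : D (a *: f) = a *: D f.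
Proof. by rewrite -[a *: f]addr0 derD.1 derD0 addr0. Qed.

Lemma derDN f : D (- f) = - D f.
Proof. by rewrite -scaleN1r derDZ scaleN1r. Qed.

Lemma derD1 : D 1 = 0.
Proof.
by apply: (addrI (D 1)); rewrite addr0 -{3}[1]mulr1 derD.2 mul1r mulr1.
Qed.

Definition der_const : {pred A} := fun f => D f == 0.

Lemma der_constP f : reflect (D f = 0) (f \in der_const). Proof. exact: eqP. Qed.

Lemma der_const_subring : subring_closed der_const.
Proof.
split=> [|f g /der_constP f0 /der_constP g0|f g /der_constP f0 /der_constP g0];
  apply/der_constP; first exact: derD1.
- by rewrite derD_add derDN f0 g0 subr0.
- by rewrite derD.2 f0 g0 mulr0 mul0r addr0.
Qed.

HB.instance Definition _ := GRing.isSubringClosed.Build A der_const der_const_subring.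

Lemma der_constZ a f : f \in der_const -> a *: f \in der_const.
Proof. by move=> /der_constP f0; apply/der_constP; rewrite derDZ f0 scaler0. Qed.

Hypothesis D_coords : forall t : A,
  t \in [:: t1; t1n; t2; t2n; t3; t3n; t4; t4n] -> t \in der_const.

Local Ltac der_const_poly := repeat
  lazymatch goal with
  | |- is_true (in_mem (_ ^+ _) _) => apply: rpredX
  | |- is_true (in_mem (_%:R) _) => apply: rpred_nat
  | |- is_true (in_mem (_ - _) _) => apply: rpredB
  | |- is_true (in_mem (_ + _) _) => apply: rpredD
  | |- is_true (in_mem (_ * _) _) => apply: rpredM
  | |- is_true (in_mem 1 _) => exact: rpred1
  | |- _ => first [assumption | by apply: D_coords; rewrite !inE eqxx ?orbT]
  end.

Lemma der_const_polP : polP \in der_const.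
Proof. by rewrite /polP; der_const_poly. Qed.

Lemma der_const_polQ : polQ \in der_const.
Proof. by rewrite /polQ; der_const_poly. Qed.

Lemma der_const_t5 : t5 \in der_const.
Proof.
have := comm_gap_neq0 char_gt3; have := t5_quadratic char_gt3.
have := der_constP _ der_const_polP; have := der_constP _ der_const_polQ.
move: polP polQ t5 => p q t dp dq tE gap; apply/der_constP/(mulfI gap).
transitivity (D (t ^+ 2 - p * t + q)); last by rewrite tE derD0 mulr0.
rewrite expr2 !derD_add derDN !derD.2 dp dq; ring.
Qed.

Lemma der_const_t5n : t5n \in der_const.
Proof.
have -> : t5n = polP - t5 :> A by rewrite (comm_sum char_gt3); ring.
by rewrite rpredB ?der_const_polP ?der_const_t5.
Qed.


(** Functions on pairs that are values of an element annihilated by [D]: traces of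
    words are first of all functions, and this spares the proof that each of them
    is regular and invariant. *)
Definition const_fun (h : pt -> K) : Prop :=
  exists2 s, s \in der_const & forall x, h x = (s : A) x.

Lemma const_fun_ext h k : h =1 k -> const_fun h -> const_fun k.
Proof. by move=> hk [s Ds sE]; exists s => // x; rewrite -hk. Qed.

Lemma const_fun_t (t : A) : t \in der_const -> const_fun t.
Proof. by exists t. Qed.

Lemma const_fun_cst c : const_fun (fun=> c).
Proof.
exists (c *: 1); first by rewrite der_constZ // rpred1.
by move=> x; rewrite crZ cr1 mulr1.
Qed.

Lemma const_funD h k : const_fun h -> const_fun k -> const_fun (fun x => h x + k x).
Proof.
by move=> [s Ds sE] [r Dr rE]; exists (s + r) => [|x]; rewrite ?rpredD // crD sE rE.
Qed.

Lemma const_funM h k : const_fun h -> const_fun k -> const_fun (fun x => h x * k x).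
Proof.
by move=> [s Ds sE] [r Dr rE]; exists (s * r) => [|x]; rewrite ?rpredM // crM sE rE.
Qed.

Lemma const_funN h : const_fun h -> const_fun (fun x => - h x).
Proof. by move=> [s Ds sE]; exists (- s) => [|x]; rewrite ?rpredN // crN sE. Qed.

Local Notation V1 x := (invmx (X1 x)).
Local Notation V2 x := (invmx (X2 x)).
Implicit Types (x : pt) (Y Z : pt -> 'M[K]_3).

Local Ltac const_t t := by apply: (@const_fun_t t); apply: D_coords; rewrite !inE eqxx ?orbT.
Let cf1 : const_fun t1. Proof. const_t (t1 : A). Qed.
Let cf1n : const_fun t1n. Proof. const_t (t1n : A). Qed.
Let cf2 : const_fun t2. Proof. const_t (t2 : A). Qed.
Let cf2n : const_fun t2n. Proof. const_t (t2n : A). Qed.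
Let cf3 : const_fun t3. Proof. const_t (t3 : A). Qed.
Let cf3n : const_fun t3n. Proof. const_t (t3n : A). Qed.
Let cf4 : const_fun t4. Proof. const_t (t4 : A). Qed.
Let cf4n : const_fun t4n. Proof. const_t (t4n : A). Qed.
Let cf5 : const_fun t5. Proof. exact/const_fun_t/der_const_t5. Qed.
Let cf5n : const_fun t5n. Proof. exact/const_fun_t/der_const_t5n. Qed.

(** By Cayley-Hamilton, the words in X2 and its inverse are combinations of 1, X2
    and X2^-1 with annihilated coefficients. *)
Definition in_span2 Z : Prop := exists a b c,
  [/\ const_fun a, const_fun b, const_fun c &
   forall x, Z x = (a x)%:M + b x *: X2 x + c x *: V2 x].

Lemma in_span2_1 : in_span2 (fun=> 1%:M).
Proof.
exists (fun=> 1), (fun=> 0), (fun=> 0); split; try exact: const_fun_cst.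
by move=> x; rewrite !scale0r !addr0.
Qed.

Let X2sqr x : X2 x *m X2 x = t2 x *: X2 x - (t2n x)%:M + V2 x.
Proof. by rewrite sqr_mx3 ?SL3_det. Qed.

Let V2sqr x : V2 x *m V2 x = t2n x *: V2 x - (t2 x)%:M + X2 x.
Proof. by rewrite sqr_mx3 ?invmxK // det_inv SL3_det invr1. Qed.

Lemma in_span2_X Z : in_span2 Z -> in_span2 (fun x => Z x *m X2 x).
Proof.
case=> a [b [c [ca cb cc ZE]]].
exists (fun x => c x + - (b x * t2n x)), (fun x => a x + b x * t2 x), b.
split=> [|||x] //; try by do ?[apply: const_funD | apply: const_funN | apply: const_funM].
rewrite ZE !mulmxDl mul_scalar_mx -!scalemxAl X2sqr mulVmx ?SL3_unit //.
move: (X2 x) (V2 x) => X V; apply/matrixP => i j; rewrite !mxE.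
by case: (i == j); rewrite ?mulr1n ?mulr0n; ring.
Qed.

Lemma in_span2_V Z : in_span2 Z -> in_span2 (fun x => Z x *m V2 x).
Proof.
case=> a [b [c [ca cb cc ZE]]].
exists (fun x => b x + - (c x * t2 x)), c, (fun x => a x + c x * t2n x).
split=> [|||x] //; try by do ?[apply: const_funD | apply: const_funN | apply: const_funM].
rewrite ZE !mulmxDl mul_scalar_mx -!scalemxAl V2sqr mulmxV ?SL3_unit //.
move: (X2 x) (V2 x) => X V; apply/matrixP => i j; rewrite !mxE.
by case: (i == j); rewrite ?mulr1n ?mulr0n; ring.
Qed.

Lemma const_fun_span Y Z : in_span2 Z ->
  const_fun (fun x => \tr (Y x)) -> const_fun (fun x => \tr (Y x *m X2 x)) ->
  const_fun (fun x => \tr (Y x *m V2 x)) -> const_fun (fun x => \tr (Y x *m Z x)).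
Proof.
case=> a [b [c [ca cb cc ZE]]] y0 y1 y2.
apply: (@const_fun_ext (fun x => a x * \tr (Y x) + b x * \tr (Y x *m X2 x)
  + c x * \tr (Y x *m V2 x))) => [x|].
  by rewrite ZE !mulmxDr mul_mx_scalar -!scalemxAr !linearD !linearZ.
by do ?[apply: const_funD | apply: const_funM].
Qed.

Lemma tr_span Z : in_span2 Z -> const_fun (fun x => \tr (Z x)).
Proof.
move=> sZ; apply: (@const_fun_ext (fun x => \tr (1%:M *m Z x))) => [x|].
  by rewrite mul1mx.
apply: const_fun_span => //.
- exact: const_fun_cst.
- by apply: const_fun_ext cf2 => x; rewrite mul1mx.
- by apply: const_fun_ext cf2n => x; rewrite mul1mx.
Qed.

Lemma tr_X1span Z : in_span2 Z -> const_fun (fun x => \tr (X1 x *m Z x)).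
Proof. by move=> sZ; apply: const_fun_span; [|exact: cf1|exact: cf3|exact: cf4]. Qed.

Lemma tr_V1span Z : in_span2 Z -> const_fun (fun x => \tr (V1 x *m Z x)).
Proof. by move=> sZ; apply: const_fun_span; [|exact: cf1n|exact: cf4n|exact: cf3n]. Qed.

(** The matrices that produce a basis of the space from an eigenvector of X1. *)
Definition frame (i : 'I_3) (x : pt) : 'M[K]_3 :=
  if i == 0 then 1%:M else if i == 1 then X2 x else V2 x.

Lemma frame_span i : in_span2 (frame i).
Proof.
have s1 := in_span2_1; elim/ord3P: i => //.
- have [a [b [c [ca cb cc E]]]] := in_span2_X s1.
  by exists a, b, c; split=> // x; rewrite -E mul1mx.
- have [a [b [c [ca cb cc E]]]] := in_span2_V s1.
  by exists a, b, c; split=> // x; rewrite -E mul1mx.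
Qed.

Lemma frame_spanM Z j : in_span2 Z -> in_span2 (fun x => Z x *m frame j x).
Proof.
move=> sZ; elim/ord3P: j; rewrite /frame /=; [|exact: in_span2_X|exact: in_span2_V].
have [a [b [c [ca cb cc E]]]] := sZ.
by exists a, b, c; split=> // x; rewrite -E mulmx1.
Qed.

Lemma tr_X1sqr_span Z : in_span2 Z -> const_fun (fun x => \tr (X1 x *m X1 x *m Z x)).
Proof.
move=> sZ.
apply: (@const_fun_ext (fun x => t1 x * \tr (X1 x *m Z x) + - (t1n x * \tr (Z x))
  + \tr (V1 x *m Z x))) => [x|].
  rewrite sqr_mx3 ?SL3_det // !mulmxDl mulNmx mul_scalar_mx -scalemxAl.
  by rewrite !linearD linearN !linearZ.
have := tr_span sZ; have := tr_X1span sZ; have := tr_V1span sZ => h1 h2 h3.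
by do ?[apply: const_funD | apply: const_funN | apply: const_funM].
Qed.

Local Ltac const_funs :=
  do ?[apply: const_funD | apply: const_funN | apply: const_funM | apply: const_fun_cst].

(** The words X1 Z X1 Z' with Z, Z' among X2, X2^-1 are covered by [tr_ABAB] and
    [tr_ABAV]. *)
Lemma tr_X1_frames i j :
  const_fun (fun x => \tr (X1 x *m (frame i x *m X1 x *m frame j x))).
Proof.
have [si sj] := (frame_span i, frame_span j).
elim/ord3P: i si => si.
- apply: const_fun_ext (tr_X1sqr_span sj) => x.
  by rewrite /frame /= mul1mx mulmxA.
- elim/ord3P: j sj => sj.
  + apply: const_fun_ext (tr_X1sqr_span si) => x.
    by rewrite /frame /= mulmx1 mulmxA [RHS]mxtrace_mulC mulmxA.
  + apply: (@const_fun_ext (fun x => t3 x * t3 x + - (2 * t3n x))) => [x|]; last by const_funs.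
    by rewrite /frame /= !mulmxA tr_ABAB ?SL3_det.
  + apply: (@const_fun_ext (fun x => t3 x * t4 x + t2 x * t3n x + - (t2 x * t2n x * t1n x)
      + t2n x * t4n x + t1n x)) => [x|]; last by const_funs.
    by rewrite /frame /= !mulmxA tr_ABAV ?SL3_det.
- elim/ord3P: j sj => sj.
  + apply: const_fun_ext (tr_X1sqr_span si) => x.
    by rewrite /frame /= mulmx1 mulmxA [RHS]mxtrace_mulC mulmxA.
  + apply: (@const_fun_ext (fun x => t3 x * t4 x + t2 x * t3n x + - (t2 x * t2n x * t1n x)
      + t2n x * t4n x + t1n x)) => [x|]; last by const_funs.
    rewrite /frame /=.
    have -> : \tr (X1 x *m (V2 x *m X1 x *m X2 x))
            = \tr (X1 x *m X2 x *m X1 x *m V2 x).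
      by rewrite -(mulmxA (V2 x)) (mulmxA (X1 x)) mxtrace_mulC !mulmxA.
    by rewrite tr_ABAV ?SL3_det.
  + apply: (@const_fun_ext (fun x => t4 x * t4 x + - (2 * t4n x))) => [x|]; last by const_funs.
    by rewrite /frame /= !mulmxA tr_ABAB ?invmxK ?det_inv ?SL3_det ?invr1.
Qed.

(** Among the words X1^-1 Z X1 Z' with Z, Z' in {X2, X2^-1} there are the two
    commutators; the other two are instances of [tr_ABAV] with the roles of the
    two matrices exchanged. *)
Lemma tr_V1_frames i j :
  const_fun (fun x => \tr (V1 x *m (frame i x *m X1 x *m frame j x))).
Proof.
have [si sj] := (frame_span i, frame_span j).
have dV x : \det (V2 x) = 1 by rewrite det_inv SL3_det invr1.
elim/ord3P: i si => si.
- apply: const_fun_ext (tr_span sj) => x.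
  by rewrite /frame /= mul1mx mulmxA mulVmx ?SL3_unit // mul1mx.
- elim/ord3P: j sj => sj.
  + apply: const_fun_ext (tr_span si) => x.
    by rewrite /frame /= mulmx1 mulmxA mxtrace_mulC mulmxA mulmxV ?SL3_unit // mul1mx.
  + apply: (@const_fun_ext (fun x => t3 x * t4n x + t1 x * t3n x
      + - (t1 x * t1n x * t2n x) + t1n x * t4 x + t2n x)) => [x|]; last by const_funs.
    rewrite /frame /= [RHS]mxtrace_mulC tr_ABAV ?SL3_det //.
    by rewrite !(mxtrace_mulC (X2 x)) !(mxtrace_mulC (V2 x)).
  + apply: const_fun_ext cf5n => x.
    by rewrite /frame /= [RHS]mxtrace_mulC.
- elim/ord3P: j sj => sj.
  + apply: const_fun_ext (tr_span si) => x.
    by rewrite /frame /= mulmx1 mulmxA mxtrace_mulC mulmxA mulmxV ?SL3_unit // mul1mx.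
  + apply: const_fun_ext cf5 => x.
    by rewrite /frame /= -(mulmxA (V2 x)) (mulmxA (V1 x)) [RHS]mxtrace_mulC mulmxA.
  + apply: (@const_fun_ext (fun x => t4 x * t3n x + t1 x * t4n x
      + - (t1 x * t1n x * t2 x) + t1n x * t3 x + t2 x)) => [x|]; last by const_funs.
    rewrite /frame /= [RHS]mxtrace_mulC tr_ABAV ?SL3_det // invmxK.
    by rewrite !(mxtrace_mulC (V2 x)) !(mxtrace_mulC (X2 x)).
Qed.

Lemma tr_frames i j : const_fun (fun x => \tr (frame i x *m X1 x *m frame j x)).
Proof.
apply: const_fun_ext (tr_X1span (frame_spanM i (frame_span j))) => x.
by rewrite [RHS]mxtrace_mulC (mulmxA (frame j x)) [RHS]mxtrace_mulC.
Qed.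

(** Functions of a pair and an eigenvalue l of its first matrix that come from
    k[l] modulo the characteristic polynomial, k being the ring of elements
    annihilated by [D]. *)
Definition root_quad (H : pt -> K -> K) : Prop := exists s0 s1 s2 : A,
  [/\ s0 \in der_const, s1 \in der_const, s2 \in der_const &
   forall x l, char_cubic x l = 0 -> H x l = s0 x + s1 x * l + s2 x * l ^+ 2].

Lemma root_quad_ext H H' : (forall x l, char_cubic x l = 0 -> H x l = H' x l) ->
  root_quad H -> root_quad H'.
Proof.
move=> HH [s0 [s1 [s2 [c0 c1 c2 E]]]]; exists s0, s1, s2; split=> // x l xl.
by rewrite -HH // E.
Qed.

Lemma root_quad_const h : const_fun h -> root_quad (fun x _ => h x).
Proof.
move=> [s cs sE]; exists s, 0, 0; split; rewrite ?rpred0 // => x l _.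
by rewrite sE !cr0 !mul0r !addr0.
Qed.

Lemma root_quad_id : root_quad (fun _ l => l).
Proof.
exists 0, 1, 0; split; rewrite ?rpred0 ?rpred1 // => x l _.
by rewrite !cr0 cr1 mul1r mul0r add0r addr0.
Qed.

Lemma root_quadD H H' : root_quad H -> root_quad H' ->
  root_quad (fun x l => H x l + H' x l).
Proof.
move=> [s0 [s1 [s2 [c0 c1 c2 E]]]] [r0 [r1 [r2 [d0 d1 d2 E']]]].
exists (s0 + r0), (s1 + r1), (s2 + r2); split; rewrite ?rpredD // => x l xl.
by rewrite E // E' // !crD; ring.
Qed.

Lemma root_quadM H H' : root_quad H -> root_quad H' ->
  root_quad (fun x l => H x l * H' x l).
Proof.
move=> [s0 [s1 [s2 [c0 c1 c2 E]]]] [r0 [r1 [r2 [d0 d1 d2 E']]]].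
have ct1 : t1 \in der_const by apply: D_coords; rewrite inE eqxx.
have ct1n : t1n \in der_const by apply: D_coords; rewrite !inE eqxx orbT.
(* The coefficients of l^3 and l^4 before reduction by the cubic. *)
pose u3 := s1 * r2 + s2 * r1; pose u4 := s2 * r2.
exists (s0 * r0 + u3 + u4 * t1), (s0 * r1 + s1 * r0 - u3 * t1n + u4 * (1 - t1 * t1n)),
  (s0 * r2 + s1 * r1 + s2 * r0 + u3 * t1 + u4 * (t1 ^+ 2 - t1n)).
split; try by rewrite /u3 /u4; der_const_poly.
move=> x l xl; rewrite E // E' // !crE; move: xl; rewrite /char_cubic.
move: (t1 x) (t1n x) (s0 x) (s1 x) (s2 x) (r0 x) (r1 x) (r2 x).
move=> a b x0 x1 x2 y0 y1 y2 h.
have l3 : l ^+ 3 = a * l ^+ 2 - b * l + 1.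
  by apply/eqP; rewrite -subr_eq0 -h; apply/eqP; ring.
by ring: l3.
Qed.

Lemma root_quadN H : root_quad H -> root_quad (fun x l => - H x l).
Proof.
move=> rH; apply: (@root_quad_ext (fun x l => -1 * H x l)) => [x l _|].
  by rewrite mulN1r.
by apply: root_quadM => //; apply/root_quad_const/const_fun_cst.
Qed.

Lemma root_quad_sum3 (F : 'I_3 -> pt -> K -> K) : (forall i, root_quad (F i)) ->
  root_quad (fun x l => \sum_i F i x l).
Proof.
move=> rF; apply: (@root_quad_ext (fun x l => F 0 x l + F 1 x l + F 2 x l)) => [x l _|].
  by rewrite sum3E.
by do !apply: root_quadD.
Qed.

Local Ltac root_quads :=
  do ?[apply: root_quadD | apply: root_quadN | apply: root_quadM].

(** For a simple eigenvalue l this is a nonzero multiple of the eigenprojection;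
    unlike the projection, it is polynomial in l and X1. *)
Definition eigen_adj x l : 'M[K]_3 := adj3 (l%:M - X1 x).

Lemma root_quad_eig Z : const_fun (fun x => \tr (X1 x *m Z x)) ->
  const_fun (fun x => \tr (V1 x *m Z x)) -> const_fun (fun x => \tr (Z x)) ->
  root_quad (fun x l => \tr (eigen_adj x l *m Z x)).
Proof.
move=> cX cV c1; apply: (@root_quad_ext (fun x l => \tr (V1 x *m Z x)
  + l * \tr (X1 x *m Z x) + (l * l - t1 x * l) * \tr (Z x))) => [x l _|].
  rewrite /eigen_adj adj3_charmx ?SL3_det // !mulmxDl mul_scalar_mx -scalemxAl.
  by rewrite !linearD !linearZ.
have h1 := root_quad_const cX; have h2 := root_quad_const cV.
have h3 := root_quad_const c1; have h4 := root_quad_const cf1; have h5 := root_quad_id.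
by root_quads.
Qed.

(** If the adjugate is u w, the entry (i, j) is w (Z_i T Z_j) u: the operator T
    paired with the vectors Z_j u and the covectors w Z_i. *)
Definition moments (T : pt -> 'M[K]_3) x l : 'M[K]_3 :=
  \matrix_(i, j) \tr (eigen_adj x l *m (frame i x *m T x *m frame j x)).

Definition gram := moments (fun=> 1%:M).

Lemma root_quad_moments_span T : (forall i, in_span2 (fun x => frame i x *m T x)) ->
  forall i j, root_quad (fun x l => moments T x l i j).
Proof.
move=> sT i j.
apply: (@root_quad_ext (fun x l => \tr (eigen_adj x l *m (frame i x *m T x *m frame j x)))).
  by move=> x l _; rewrite mxE.
have sij := frame_spanM j (sT i).
by apply: root_quad_eig; [apply: tr_X1span | apply: tr_V1span | apply: tr_span].
Qed.

Lemma root_quad_gram i j : root_quad (fun x l => gram x l i j).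
Proof.
apply: root_quad_moments_span => {}i.
have [a [b [c [ca cb cc E]]]] := frame_span i.
by exists a, b, c; split=> // x; rewrite -E mulmx1.
Qed.

Lemma root_quad_moments2 i j : root_quad (fun x l => moments (@X2 K) x l i j).
Proof. by apply: root_quad_moments_span => {}i; apply/in_span2_X/frame_span. Qed.

Lemma root_quad_moments1 i j : root_quad (fun x l => moments (@X1 K) x l i j).
Proof.
apply: (@root_quad_ext (fun x l => \tr (eigen_adj x l *m (frame i x *m X1 x *m frame j x)))).
  by move=> x l _; rewrite mxE.
by apply: root_quad_eig; [apply: tr_X1_frames | apply: tr_V1_frames | apply: tr_frames].
Qed.

Lemma root_quad_det_gram : root_quad (fun x l => \det (gram x l)).
Proof.
have rg := root_quad_gram.
apply: (@root_quad_ext (fun x l => _)) => [x l _|]; first by rewrite det3E; reflexivity.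
by root_quads.
Qed.

Lemma root_quad_adj_moments T : (forall i j, root_quad (fun x l => moments T x l i j)) ->
  forall i j, root_quad (fun x l => (adj3 (gram x l) *m moments T x l) i j).
Proof.
move=> rT i j; have rg := root_quad_gram.
apply: (@root_quad_ext (fun x l => \sum_k adj3 (gram x l) i k * moments T x l k j)).
  by move=> x l _; rewrite [RHS]mxE.
apply: root_quad_sum3 => k; apply: root_quadM => //.
apply: (@root_quad_ext (fun x l =>
  gram x l (k + 1) (i + 1) * gram x l (k + 2) (i + 2)
  + - (gram x l (k + 1) (i + 2) * gram x l (k + 2) (i + 1)))).
  by move=> x l _; rewrite [RHS]mxE.
by root_quads.
Qed.


Definition normal_form T x l : 'M[K]_3 := invmx (gram x l) *m moments T x l.

(** The change of basis has columns Z_j u.  Its matrix U and the matrix W with rows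
    w Z_i satisfy gram = W U and moments T = W T U, whence
    gram^-1 (moments T) = U^-1 T U. *)
Lemma conj_normal_form x l : char_cubic x l = 0 -> \det (gram x l) != 0 ->
  exists2 U : 'M[K]_3, U \in unitmx & forall T, U *m normal_form T x l = T x *m U.
Proof.
rewrite charpE => /adj3_rank1[u [w eE]] dG.
pose U : 'M[K]_3 := \matrix_(k, j) (frame j x *m u) k 0.
pose W : 'M[K]_3 := \matrix_(i, k) (w *m frame i x) 0 k.
have momE T : moments T x l = W *m T x *m U.
  have trE (B : 'M[K]_3) : \tr (u *m w *m B) = (w *m B *m u) 0 0.
    by rewrite -mulmxA mxtrace_mulC trace_mx11.
  apply/matrixP => i j; rewrite [LHS]mxE /eigen_adj eE trE !mulmxA.
  rewrite -[_ *m frame j x *m u]mulmxA [LHS]mxE [RHS]mxE.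
  apply: eq_bigr => k _; rewrite [U k j]mxE; congr (_ * _).
  by rewrite !mxE; apply: eq_bigr => a _; rewrite [W i a]mxE.
have gE : gram x l = W *m U by rewrite /gram momE mulmx1.
have := dG; rewrite gE det_mulmx mulf_eq0 negb_or => /andP[dW dU].
have uU : U \in unitmx by rewrite unitmxE unitfE.
have uW : W \in unitmx by rewrite unitmxE unitfE.
exists U => // T; have uG : gram x l \in unitmx by rewrite unitmxE unitfE.
rewrite /normal_form momE; apply: (can_inj (mulKmx uW)).
by rewrite !mulmxA -gE mulmxV // mul1mx.
Qed.

Definition slice x l : 'I_(3 * 3 + 3 * 3) -> K :=
  row_mx (mxvec (normal_form (@X1 K) x l)) (mxvec (normal_form (@X2 K) x l)) 0.

Lemma slice_eval (f : A) (p : mpoly (3 * 3 + 3 * 3) K) x l :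
  (forall y, f y = meval (coords y) p) ->
  char_cubic x l = 0 -> \det (gram x l) != 0 -> f x = meval (slice x l) p.
Proof.
move=> fE xl dG; have [U uU nfE] := conj_normal_form xl dG.
have det_nf T : \det (T x) = 1 -> \det (normal_form T x l) == 1.
  move=> dT; have dU : \det U != 0 by rewrite -unitfE -unitmxE.
  have := congr1 determinant (nfE T).
  by rewrite !det_mulmx dT mul1r -[RHS]mulr1 => /(mulfI dU)/eqP.
pose y1 : SL3 K := Sub (normal_form (@X1 K) x l) (det_nf _ (SL3_det x.1)).
pose y2 : SL3 K := Sub (normal_form (@X2 K) x l) (det_nf _ (SL3_det x.2)).
by rewrite -(@coord_ring_GLconj _ f U (y1, y2) x) ?nfE // fE.
Qed.

(** As [root_quad], after multiplication by a power of the Gram determinant. *)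
Definition ratio_quad (H : pt -> K -> K) : Prop := exists k F, root_quad F /\
  forall x l, char_cubic x l = 0 -> \det (gram x l) != 0 ->
    H x l * \det (gram x l) ^+ k = F x l.

Lemma ratio_quad_ext H H' : (forall x l, H x l = H' x l) ->
  ratio_quad H -> ratio_quad H'.
Proof.
by move=> HH [k [F [rF E]]]; exists k, F; split=> // x l xl dx; rewrite -HH E.
Qed.

Lemma root_quadX H k : root_quad H -> root_quad (fun x l => H x l ^+ k).
Proof.
move=> rH; elim: k => [|k IH].
  exact: (root_quad_const (const_fun_cst 1)).
apply: (@root_quad_ext (fun x l => H x l * H x l ^+ k)) => [x l _|].
  by rewrite exprS.
exact: root_quadM.
Qed.

Lemma ratio_quadD H H' : ratio_quad H -> ratio_quad H' ->
  ratio_quad (fun x l => H x l + H' x l).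
Proof.
move=> [k [F [rF E]]] [k' [F' [rF' E']]]; have rg := root_quad_det_gram.
exists (k + k')%N, (fun x l => F x l * \det (gram x l) ^+ k' +
  F' x l * \det (gram x l) ^+ k); split.
  by apply: root_quadD; apply: root_quadM => //; apply: root_quadX.
by move=> x l xl dx; rewrite -E // -E' // exprD; ring.
Qed.

Lemma ratio_quadM H H' : ratio_quad H -> ratio_quad H' ->
  ratio_quad (fun x l => H x l * H' x l).
Proof.
move=> [k [F [rF E]]] [k' [F' [rF' E']]].
exists (k + k')%N, (fun x l => F x l * F' x l); split; first exact: root_quadM.
by move=> x l xl dx; rewrite -E // -E' // exprD; ring.
Qed.

Lemma ratio_quad_cst c : ratio_quad (fun _ _ => c).
Proof.
exists 0%N, (fun _ _ => c); split=> [|x l _ _]; last by rewrite mulr1.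
exact: (root_quad_const (const_fun_cst c)).
Qed.

Lemma ratio_quad_normal_form T i j :
  (forall i j, root_quad (fun x l => moments T x l i j)) ->
  ratio_quad (fun x l => normal_form T x l i j).
Proof.
move=> rT; exists 1%N, (fun x l => (adj3 (gram x l) *m moments T x l) i j).
split=> [|x l _ dG]; first exact: root_quad_adj_moments.
have -> : adj3 (gram x l) = \det (gram x l) *: invmx (gram x l).
  have uG : gram x l \in unitmx by rewrite unitmxE unitfE.
  apply: (can_inj (mulKmx uG)).
  by rewrite mul_adj3 -scalemxAr mulmxV // scalemx1.
by rewrite -scalemxAl [RHS]mxE expr1 mulrC.
Qed.

Lemma ratio_quad_slice i : ratio_quad (fun x l => slice x l i).
Proof.
rewrite /slice; case: (split_ordP i) => k ->; case/mxvec_indexP: k => a b.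
  apply: ratio_quad_ext (ratio_quad_normal_form a b root_quad_moments1) => x l.
  by rewrite row_mxEl mxvecE.
apply: ratio_quad_ext (ratio_quad_normal_form a b root_quad_moments2) => x l.
by rewrite row_mxEr mxvecE.
Qed.

Lemma ratio_quad_meval (p : mpoly (3 * 3 + 3 * 3) K) :
  ratio_quad (fun x l => meval (slice x l) p).
Proof.
have rX i n : ratio_quad (fun x l => slice x l i ^+ n).
  elim: n => [|n IH]; first exact: ratio_quad_cst.
  by apply: ratio_quad_ext (ratio_quadM (ratio_quad_slice i) IH) => x l; rewrite exprS.
have rprod (m : multinom (3 * 3 + 3 * 3)) (r : seq 'I_(3 * 3 + 3 * 3)) :
    ratio_quad (fun x l => \prod_(i <- r) slice x l i ^+ m i).
  elim: r => [|i r IH].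
    by apply: ratio_quad_ext (ratio_quad_cst 1) => x l; rewrite big_nil.
  by apply: ratio_quad_ext (ratio_quadM (rX i (m i)) IH) => x l; rewrite big_cons.
have rsum (r : seq (multinom (3 * 3 + 3 * 3))) : ratio_quad (fun x l =>
    \sum_(m <- r) mcoeff m p * \prod_i slice x l i ^+ m i).
  elim: r => [|m r IH].
    by apply: ratio_quad_ext (ratio_quad_cst 0) => x l; rewrite big_nil.
  apply: ratio_quad_ext (ratio_quadD (ratio_quadM (ratio_quad_cst (mcoeff m p))
    (rprod m _)) IH) => x l.
  by rewrite big_cons.
by apply: ratio_quad_ext (rsum _) => x l; rewrite mevalE.
Qed.

Local Notation sample := (sample char_gt3).

Lemma charp_sample : char_cubic sample 1 = 0.
Proof.
have e1 : val sample.1 = diag_mx (sample_eig K) by [].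
rewrite /char_cubic !(diag_tracesE e1) !mxE /=; field; exact: two_neq0.
Qed.

Lemma det_gram_sample : \det (gram sample 1) != 0.
Proof.
have e1 : X1 sample = diag_mx (sample_eig K) by [].
have e2 : X2 sample = \matrix_(i, j) (j == i + 1)%:R by [].
have h2 := two_neq0 char_gt3.
have eigE : eigen_adj sample 1 = diag_mx (\row_j if j == 0 then - 2^-1 else 0).
  apply/matrixP; rewrite /eigen_adj e1; elim/ord3P; elim/ord3P;
    rewrite !mxE !ord3D /= ?mulr1n ?mulr0n; by field; rewrite ?(four_neq0 char_gt3) ?h2.
have vE : V2 sample = \matrix_(i, j) (i == j + 1)%:R.
  rewrite invmx3 ?SL3_det // e2; apply/matrixP; elim/ord3P; elim/ord3P;
    rewrite !mxE !ord3D /=; ring.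
have gE i j : gram sample 1 i j = - 2^-1 * (frame i sample *m frame j sample) 0 0.
  rewrite mxE mulmx1 eigE tr3E !mul_diag_mx !mxE /=.
  by rewrite !mul0r !addr0.
rewrite det3E !gE /frame /= !mul1mx !mulmx1 e2 vE !(mxE, sum3E) !ord3D /=.
have nz (z : K) : z = 2^-1 ^+ 3 -> z != 0.
  by move=> ->; rewrite expf_neq0 ?invr_neq0.
by apply: nz; ring.
Qed.

(** The three roots l of the cubic turn f d^(k+1) = F d, an identity between
    quadratic polynomials in l, into three identities f s_j = r_j in A with s_j
    and r_j annihilated; the sample pair shows that some s_j is not zero. *)
Lemma derivation_rigidity (f : A) : D f = 0.
Proof.
have [[p fE] _] := inv_regularP _ (cr_funP f).
have [k [F [rF E]]] := ratio_quad_meval p.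
have rG := root_quad_det_gram.
have [s0 [s1 [s2 [c0 c1 c2 sE]]]] := root_quadX k.+1 rG.
(* One more factor d makes the identity hold also where d vanishes. *)
have [r0 [r1 [r2 [d0 d1 d2 rE]]]] := root_quadM rF rG.
have key x l : char_cubic x l = 0 ->
    (f x * s0 x - r0 x) + (f x * s1 x - r1 x) * l + (f x * s2 x - r2 x) * l ^+ 2 = 0.
  move=> xl; transitivity (f x * (s0 x + s1 x * l + s2 x * l ^+ 2)
    - (r0 x + r1 x * l + r2 x * l ^+ 2)); first by ring.
  rewrite -sE // -rE //; have [->|dG] := eqVneq (\det (gram x l)) 0.
    by rewrite expr0n /= !mulr0 subr0.
  by rewrite -E // -(slice_eval fE) // exprSr; ring.
have [e0 e1 e2] : [/\ f * s0 = r0, f * s1 = r1 & f * s2 = r2].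
  suff H x : disc x != 0 -> [/\ (f * s0) x = r0 x, (f * s1) x = r1 x & (f * s2) x = r2 x].
    by split; apply: (disc_dense char_gt3) => x /H[].
  have [l [m [n [lmn S1 S2 _]]]] := charp_roots x.
  rewrite (disc_roots lmn S1 S2) sqrf_eq0 !mulf_eq0 !subr_eq0 !negb_or.
  case/andP=> /andP[lm mn] nl.
  have rt z : (z - l) * (z - m) * (z - n) = 0 -> char_cubic x z = 0.
    by rewrite /char_cubic S1 S2 => <-; ring: lmn.
  have kl := key x l (rt l _); have km := key x m (rt m _); have kn := key x n (rt n _).
  have [|||] := quadratic_3roots lm mn nl (kl _) (km _) (kn _); try by rewrite subrr ?(mul0r,
    mulr0).
  by move=> /subr0_eq a /subr0_eq b /subr0_eq c; rewrite !crM.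
have Dz s r : s \in der_const -> r \in der_const -> f * s = r -> D f * s = 0.
  move=> /der_constP Ds /der_constP Dr /(congr1 D).
  by rewrite derD.2 Ds Dr mulr0 add0r.
apply/eqP; apply/negPn/negP => Df0.
have z s r : s \in der_const -> r \in der_const -> f * s = r -> s = 0.
  move=> cs cr /Dz => /(_ cs cr) /eqP.
  by rewrite mulf_eq0 (negPf Df0) => /eqP.
have := sE sample 1 charp_sample.
rewrite (z s0 r0) // (z s1 r1) // (z s2 r2) // !cr0 !mul0r !addr0 => /eqP.
by rewrite expf_eq0 (negPf det_gram_sample) andbF.
Qed.

End Rigidity.

(** * Polynomial curves of matrices and transvections *)

Section PolyMatrix.
Variable K : closedFieldType.

Definition mx_at (t : K) (c : 'M[{poly K}]_3) : 'M[K]_3 := map_mx (horner_eval t) c.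

Definition velocity (c : 'M[{poly K}]_3) : 'M[K]_3 :=
  map_mx (fun p => (p^`()).[0]) c.

Definition line (W : 'M[K]_3) : 'M[{poly K}]_3 :=
  1%:M + 'X *: map_mx polyC W.

Lemma mx_atM t c d : mx_at t (c *m d) = mx_at t c *m mx_at t d.
Proof. exact: map_mxM. Qed.

Lemma velocityM c d :
  velocity (c *m d) = velocity c *m mx_at 0 d + mx_at 0 c *m velocity d.
Proof.
apply/matrixP => i j; rewrite !mxE -big_split /=.
rewrite raddf_sum -horner_evalE raddf_sum /=; apply: eq_bigr => k _.
by rewrite !mxE !horner_evalE derivM hornerD !hornerM.
Qed.

Lemma mx_at_line t W : mx_at t (line W) = 1%:M + t *: W.
Proof.
by apply/matrixP => i j; rewrite !mxE horner_evalE !hornerE hornerMn hornerC.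
Qed.

Lemma velocity_line W : velocity (line W) = W.
Proof.
apply/matrixP => i j; rewrite !mxE derivD derivMn derivC derivM derivX derivC.
by rewrite mul0rn add0r mulr0 addr0 mul1r hornerC.
Qed.

Lemma mx_at_const t W : mx_at t (map_mx polyC W) = W.
Proof. by apply/matrixP => i j; rewrite !mxE horner_evalE hornerC. Qed.

Lemma velocity_const W : velocity (map_mx polyC W) = 0.
Proof. by apply/matrixP => i j; rewrite !mxE derivC horner0. Qed.

Lemma poly_ext (p q : {poly K}) : (forall t, p.[t] = q.[t]) -> p = q.
Proof.
move=> pq; apply/eqP; rewrite -subr_eq0; apply/negPn/negP => /closed_nonrootP[t].
by rewrite /root hornerD hornerN pq subrr eqxx.
Qed.

Lemma det_transvection (u : 'cV[K]_3) (v : 'rV[K]_3) (t : K) :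
  v *m u = 0 -> \det (1%:M + t *: (u *m v)) == 1.
Proof.
move=> /matrixP/(_ 0 0); rewrite !mxE sum3E => vu.
apply/eqP; rewrite det3E !mxE !big_ord1 /= ?mulr1n ?mulr0n.
transitivity (1 + t * (v 0 0 * u 0 0 + v 0 1 * u 1 0 + v 0 2 * u 2 0)); first by ring.
by rewrite vu mulr0 addr0.
Qed.

(** Transvections are curves in SL(3) which are polynomial in the parameter and
    whose directions span the Lie algebra, so they detect gradients. *)
Definition transvection u v t (vu : v *m u = 0) : SL3 K :=
  Sub (1%:M + t *: (u *m v)) (det_transvection t vu).

Lemma inv_transvection u v t (vu : v *m u = 0) :
  invmx (val (transvection t vu)) = 1%:M - t *: (u *m v).
Proof.
have uT := SL3_unit (transvection t vu).
apply: (can_inj (mulKmx uT)); rewrite mulmxV //=.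
rewrite mulmxBr mulmx1 mulmxDl mul1mx -!scalemxAl -!scalemxAr.
by rewrite mulmxA -(mulmxA u v u) vu mulmx0 mul0mx !scaler0 addr0 addrK.
Qed.

(** The orthogonal of the traceless matrices for the trace form consists of the
    scalar matrices, and the traceless matrices are spanned by the nilpotent
    matrices of rank one. *)
Lemma scalar_mx_transvection (M : 'M[K]_3) :
  (forall (u : 'cV_3) (v : 'rV_3), v *m u = 0 -> \tr (u *m v *m M) = 0) ->
  exists s, M = s%:M.
Proof.
move=> H; have {}H (u : 'cV_3) (v : 'rV_3) : v *m u = 0 -> (v *m M *m u) 0 0 = 0.
  by move=> /H; rewrite -mulmxA mxtrace_mulC trace_mx11.
have off i j : i != j -> M i j = 0.
  move=> ij; have := H (delta_mx j 0) (delta_mx 0 i).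
  by rewrite mul_delta_mx_0 // -rowE -colE !mxE => ->.
have diag i j : i != j -> M i i = M j j.
  move=> ij; have ji : j != i by rewrite eq_sym.
  have := H (delta_mx i 0 + delta_mx j 0) (delta_mx 0 i - delta_mx 0 j).
  rewrite mulmxDr !mulmxBl !mul_delta_mx !mul_delta_mx_0 // subr0 sub0r subrr.
  move=> /(_ erefl); rewrite !mulmxDr -!rowE -!colE !mxE.
  by rewrite (off i j) // (off j i) // addr0 add0r => /subr0_eq.
exists (M 0 0); apply/matrixP => i j; rewrite mxE.
have [<-|ij] := eqVneq i j; last by rewrite off.
by have [->|i0] := eqVneq i 0; rewrite // (diag i 0).
Qed.

Lemma SL3_mul_det (g h : SL3 K) : \det (val g *m val h) == 1.
Proof. by rewrite det_mulmx !SL3_det mulr1. Qed.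

Definition SL3_mul (g h : SL3 K) : SL3 K := Sub (val g *m val h) (SL3_mul_det g h).

End PolyMatrix.

(** * Gradients of regular functions *)

Section Gradient.
Variable K : closedFieldType.
Local Notation pt := (SL3 K * SL3 K)%type.
Implicit Types (f g : pt -> K) (x : pt).

Definition poly_curve (c : K -> pt) (c1 c2 : 'M[{poly K}]_3) : Prop :=
  forall t, val (c t).1 = mx_at t c1 /\ val (c t).2 = mx_at t c2.

(** Derivatives are taken along polynomial curves in SL(3) x SL(3): the derivative
    of a regular function is then that of a polynomial, and no choice of a
    polynomial representing the function is involved. *)
Definition is_gradient f x G1 G2 : Prop :=
  forall c c1 c2, c 0 = x -> poly_curve c c1 c2 -> exists2 r : {poly K},
    forall t, f (c t) = r.[t] & (r^`()).[0] = \tr (velocity c1 *m G1) + \tr (velocity c2 *m G2).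

Lemma is_gradient_cst (a : K) x : is_gradient (fun=> a) x 0 0.
Proof.
move=> c c1 c2 _ _; exists a%:P => [t|]; first by rewrite hornerC.
by rewrite derivC horner0 !mulmx0 linear0 addr0.
Qed.

Lemma is_gradientD f g x G1 G2 H1 H2 :
  is_gradient f x G1 G2 -> is_gradient g x H1 H2 ->
  is_gradient (fun y => f y + g y) x (G1 + H1) (G2 + H2).
Proof.
move=> df dg c c1 c2 c0 pc; have [r rE r1] := df _ _ _ c0 pc.
have [s sE s1] := dg _ _ _ c0 pc; exists (r + s) => [t|].
  by rewrite hornerD rE sE.
by rewrite derivD hornerD r1 s1 !mulmxDr !linearD; ring.
Qed.

Lemma is_gradientM f g x G1 G2 H1 H2 :
  is_gradient f x G1 G2 -> is_gradient g x H1 H2 ->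
  is_gradient (fun y => f y * g y) x (f x *: H1 + g x *: G1) (f x *: H2 + g x *: G2).
Proof.
move=> df dg c c1 c2 c0 pc; have [r rE r1] := df _ _ _ c0 pc.
have [s sE s1] := dg _ _ _ c0 pc; exists (r * s) => [t|].
  by rewrite hornerM rE sE.
rewrite derivM hornerD !hornerM r1 s1 -rE -sE c0 !mulmxDr -!scalemxAr.
by rewrite !linearD !linearZ /=; ring.
Qed.

Lemma mxtrace_mul_delta (V : 'M[K]_3) i j : \tr (V *m delta_mx j i) = V i j.
Proof.
rewrite -(mul_delta_mx (0 : 'I_1)) mulmxA mxtrace_mulC trace_mx11 mulmxA.
by rewrite -rowE -colE !mxE.
Qed.

Lemma is_gradient_X1 i j x : is_gradient (fun y => X1 y i j) x (delta_mx j i) 0.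
Proof.
move=> c c1 c2 c0 pc; exists (c1 i j) => [t|].
  by have [cE _] := pc t; rewrite /X1 cE !mxE.
by rewrite mulmx0 linear0 addr0 mxtrace_mul_delta mxE.
Qed.

Lemma is_gradient_X2 i j x : is_gradient (fun y => X2 y i j) x 0 (delta_mx j i).
Proof.
move=> c c1 c2 c0 pc; exists (c2 i j) => [t|].
  by have [_ cE] := pc t; rewrite /X2 cE !mxE.
by rewrite mulmx0 linear0 add0r mxtrace_mul_delta mxE.
Qed.

Definition regular_mx (G : pt -> 'M[K]_3) : Prop :=
  forall i j, regular_fun (fun x => G x i j).

Definition gradient_field f (F : (pt -> 'M[K]_3) * (pt -> 'M[K]_3)) : Prop :=
  [/\ regular_mx F.1, regular_mx F.2 & forall x, is_gradient f x (F.1 x) (F.2 x)].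

Lemma regular_mx_cst (M : 'M[K]_3) : regular_mx (fun=> M).
Proof. by move=> i j; apply: regular_cst. Qed.

Lemma regular_ext f g : f =1 g -> regular_fun f -> regular_fun g.
Proof. by move=> fg [p pE]; exists p => x; rewrite -fg. Qed.

Lemma regular_mxD F G : regular_mx F -> regular_mx G -> regular_mx (fun x => F x + G x).
Proof.
move=> rF rG i j; apply: regular_ext (regularD (rF i j) (rG i j)) => x.
by rewrite mxE.
Qed.

Lemma regular_mxZ f F : regular_fun f -> regular_mx F -> regular_mx (fun x => f x *: F x).
Proof.
move=> rf rF i j; apply: regular_ext (regularM rf (rF i j)) => x.
by rewrite mxE.
Qed.

Lemma regular_mxM F G : regular_mx F -> regular_mx G -> regular_mx (fun x => F x *m G x).
Proof.
move=> rF rG i j; apply: (@regular_ext (fun x => \sum_k F x i k * G x k j)) => [x|].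
  by rewrite mxE.
by apply: regular_sum => k _; apply: regularM.
Qed.

Lemma regular_mxtrace F : regular_mx F -> regular_fun (fun x => \tr (F x)).
Proof. by move=> rF; apply: regular_sum => i _. Qed.

Definition has_gradient f : Prop := regular_fun f /\ exists F, gradient_field f F.

Lemma is_gradient_ext f g x G1 G2 :
  f =1 g -> is_gradient f x G1 G2 -> is_gradient g x G1 G2.
Proof.
move=> fg df c c1 c2 c0 pc; have [r rE r1] := df _ _ _ c0 pc.
by exists r => // t; rewrite -fg.
Qed.

Lemma has_gradient_ext f g : f =1 g -> has_gradient f -> has_gradient g.
Proof.
move=> fg [rf [F [r1 r2 dF]]]; split; first exact: regular_ext rf.
by exists F; split=> // x; apply: is_gradient_ext (dF x).
Qed.

Lemma has_gradient_cst a : has_gradient (fun=> a).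
Proof.
split; first exact: regular_cst.
exists (fun=> 0, fun=> 0); split; try exact: regular_mx_cst.
by move=> x; apply: is_gradient_cst.
Qed.

Lemma has_gradientD f g : has_gradient f -> has_gradient g ->
  has_gradient (fun x => f x + g x).
Proof.
move=> [rf [F [r1 r2 dF]]] [rg [G [s1 s2 dG]]]; split; first exact: regularD.
exists (fun x => F.1 x + G.1 x, fun x => F.2 x + G.2 x).
split; try exact: regular_mxD.
by move=> x; apply: is_gradientD.
Qed.

Lemma has_gradientM f g : has_gradient f -> has_gradient g ->
  has_gradient (fun x => f x * g x).
Proof.
move=> [rf [F [r1 r2 dF]]] [rg [G [s1 s2 dG]]]; split; first exact: regularM.
exists (fun x => f x *: G.1 x + g x *: F.1 x, fun x => f x *: G.2 x + g x *: F.2 x).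
split; try by apply: regular_mxD; apply: regular_mxZ.
by move=> x; apply: is_gradientM.
Qed.

Lemma has_gradient_coords i : has_gradient (fun x => coords x i).
Proof.
rewrite /coords; case: (split_ordP i) => k ->; case/mxvec_indexP: k => a b.
  apply: (@has_gradient_ext (fun x => X1 x a b)) => [x|].
    by rewrite row_mxEl mxvecE.
  split; first by have [r _] := @reg_equivariant_X1 K.
  exists (fun=> delta_mx b a, fun=> 0); split; try exact: regular_mx_cst.
  by move=> x; apply: is_gradient_X1.
apply: (@has_gradient_ext (fun x => X2 x a b)) => [x|].
  by rewrite row_mxEr mxvecE.
split; first by have [r _] := @reg_equivariant_X2 K.
exists (fun=> 0, fun=> delta_mx b a); split; try exact: regular_mx_cst.
by move=> x; apply: is_gradient_X2.
Qed.

(** Coordinates and constants have constant gradients, and the rules for sums and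
    products do the rest. *)
Lemma regular_has_gradient f : regular_fun f -> has_gradient f.
Proof.
move=> [p pE]; apply: (@has_gradient_ext (fun x => meval (coords x) p)) => [x|].
  by rewrite pE.
have gX i n : has_gradient (fun x => coords x i ^+ n).
  elim: n => [|n IH]; first exact: has_gradient_cst.
  by apply: has_gradient_ext (has_gradientM (has_gradient_coords i) IH) => x; rewrite exprS.
have gprod (m : multinom (3 * 3 + 3 * 3)) (r : seq 'I_(3 * 3 + 3 * 3)) :
    has_gradient (fun x => \prod_(i <- r) coords x i ^+ m i).
  elim: r => [|i r IH].
    by apply: has_gradient_ext (has_gradient_cst 1) => x; rewrite big_nil.
  by apply: has_gradient_ext (has_gradientM (gX i (m i)) IH) => x; rewrite big_cons.
have gsum (r : seq (multinom (3 * 3 + 3 * 3))) : has_gradient (fun x =>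
    \sum_(m <- r) mcoeff m p * \prod_i coords x i ^+ m i).
  elim: r => [|m r IH].
    by apply: has_gradient_ext (has_gradient_cst 0) => x; rewrite big_nil.
  apply: has_gradient_ext (has_gradientD (has_gradientM (has_gradient_cst (mcoeff m p))
    (gprod m _)) IH) => x.
  by rewrite big_cons.
by apply: has_gradient_ext (gsum _) => x; rewrite mevalE.
Qed.

Implicit Types (u : 'cV[K]_3) (v : 'rV[K]_3).

(** The weaker condition that tests a gradient only along transvections in one of
    the two factors.  It determines the gradient up to what is irrelevant, and it
    is easy to check for traces of words, which are affine along such curves. *)
Definition transvection_gradient f x G1 G2 : Prop :=
  forall u v (vu : v *m u = 0),
    (exists2 r : {poly K}, forall t, f (SL3_mul (transvection t vu) x.1, x.2) = r.[t] &
       (r^`()).[0] = \tr (u *m v *m (X1 x *m G1))) /\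
    (exists2 r : {poly K}, forall t, f (x.1, SL3_mul (transvection t vu) x.2) = r.[t] &
       (r^`()).[0] = \tr (u *m v *m (X2 x *m G2))).

Lemma gradient_transvection f x G1 G2 : is_gradient f x G1 G2 -> transvection_gradient f x G1
  G2.
Proof.
move=> df u v vu.
have SL3_mul1 (g : SL3 K) : SL3_mul (transvection 0 vu) g = g.
  by apply: val_inj; rewrite /= scale0r addr0 mul1mx.
split.
- pose c t := (SL3_mul (transvection t vu) x.1, x.2).
  have [||r rE r1] := df c (line (u *m v) *m map_mx polyC (X1 x)) (map_mx polyC (X2 x)).
  + by rewrite /c SL3_mul1; case: (x).
  + by move=> t; rewrite mx_atM mx_at_line !mx_at_const.
  exists r => //; rewrite r1 velocityM velocity_line !velocity_const mulmx0 mul0mx.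
  by rewrite !addr0 linear0 addr0 mx_at_const -mulmxA.
- pose c t := (x.1, SL3_mul (transvection t vu) x.2).
  have [||r rE r1] := df c (map_mx polyC (X1 x)) (line (u *m v) *m map_mx polyC (X2 x)).
  + by rewrite /c SL3_mul1; case: (x).
  + by move=> t; rewrite mx_atM mx_at_line !mx_at_const.
  exists r => //; rewrite r1 velocityM velocity_line !velocity_const mulmx0 mul0mx.
  by rewrite linear0 add0r addr0 mx_at_const -mulmxA.
Qed.

(** The tangent space of SL(3) at X consists of the products of a traceless matrix
    with X, so a gradient is defined modulo multiples of X^-1. *)
Lemma transvection_gradient_unique f x G1 G2 H1 H2 :
  transvection_gradient f x G1 G2 -> transvection_gradient f x H1 H2 ->
  exists s1 s2, G1 = H1 + s1 *: invmx (X1 x) /\ G2 = H2 + s2 *: invmx (X2 x).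
Proof.
move=> dG dH.
have solve (X B C : 'M[K]_3) : X \in unitmx ->
    (forall u v, v *m u = 0 -> \tr (u *m v *m (X *m B)) = \tr (u *m v *m (X *m C))) ->
    exists s, B = C + s *: invmx X.
  move=> uX eGH; have [u v vu|s sE] := @scalar_mx_transvection K (X *m (B - C)).
    by rewrite !mulmxBr linearB /= eGH // subrr.
  exists s; apply: (can_inj (mulKmx uX)); rewrite mulmxDr -scalemxAr mulmxV //.
  by rewrite scalemx1 -sE mulmxBr addrC subrK.
have [|s1 e1] := solve (X1 x) G1 H1 (SL3_unit _).
  move=> u v vu; have [[r rE <-] _] := dG _ _ vu; have [[r' rE' <-] _] := dH _ _ vu.
  by rewrite (@poly_ext _ r r') // => t; rewrite -rE.
have [|s2 e2] := solve (X2 x) G2 H2 (SL3_unit _).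
  move=> u v vu; have [_ [r rE <-]] := dG _ _ vu; have [_ [r' rE' <-]] := dH _ _ vu.
  by rewrite (@poly_ext _ r r') // => t; rewrite -rE.
by exists s1, s2.
Qed.

End Gradient.

(** * The bracket *)

Section Bracket.
Variable K : closedFieldType.
Local Notation A := (coord_ring K).
Local Notation pt := (SL3 K * SL3 K)%type.
Local Notation V1 x := (invmx (X1 x)).
Local Notation V2 x := (invmx (X2 x)).
Implicit Types (f g h : A) (x y : pt).

(** The contribution of one factor to the bracket of two functions with gradients
    G and H at X. *)
Definition pairing (X G H : 'M[K]_3) : K := \tr (X *m X *m (G *m H - H *m G)).

Lemma pairingC X G H : pairing X H G = - pairing X G H.
Proof. by rewrite /pairing -opprB mulmxN raddfN. Qed.

Lemma pairingD X G1 G2 H : pairing X (G1 + G2) H = pairing X G1 H + pairing X G2 H.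
Proof.
by rewrite /pairing mulmxDl [H *m _]mulmxDr opprD addrACA -mxtraceD -mulmxDr.
Qed.

Lemma pairingZ X a G H : pairing X (a *: G) H = a * pairing X G H.
Proof.
by rewrite /pairing -scalemxAl -[H *m _]scalemxAr -scalerBr -scalemxAr linearZ.
Qed.

(** This makes the bracket independent of the choice of gradients. *)
Lemma pairing_inv X H : X \in unitmx -> pairing X (invmx X) H = 0.
Proof.
move=> uX; rewrite /pairing mulmxBr linearB /= !mulmxA mulmxK //.
by rewrite [X in _ - X]mxtrace_mulC !mulmxA mulVmx // mul1mx subrr.
Qed.

Lemma pairing_conj (P X G H : 'M[K]_3) : P \in unitmx ->
  pairing (P *m X *m invmx P) (P *m G *m invmx P) (P *m H *m invmx P) = pairing X G H.
Proof.
move=> uP.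
have cM B C : (P *m B *m invmx P) *m (P *m C *m invmx P) = P *m (B *m C) *m invmx P.
  by rewrite !mulmxA mulmxKV.
rewrite /pairing !cM -mulmxBl -mulmxBr cM mxtrace_mulC.
by rewrite mulKmx.
Qed.

Lemma grad_exists f : exists F, gradient_field f F.
Proof. by have [_] := regular_has_gradient (inv_regularP _ (cr_funP f)).1. Qed.

Definition grad f : (pt -> 'M[K]_3) * (pt -> 'M[K]_3) := projT1 (cid (grad_exists f)).

Lemma gradP f : gradient_field f (grad f).
Proof. exact: projT2 (cid (grad_exists f)). Qed.

Lemma is_gradient_grad f x : is_gradient f x ((grad f).1 x) ((grad f).2 x).
Proof. by have [_ _] := gradP f. Qed.
Arguments is_gradient_grad : clear implicits.

(** The factor - 1/2 gives {t_(4), t_(-4)} the value P - 2 t_(5). *)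
Definition bracket_fun f g x : K := - 2^-1 *
  (pairing (X1 x) ((grad f).1 x) ((grad g).1 x) + pairing (X2 x) ((grad f).2 x) ((grad g).2 x)).

Lemma pairing_shift X G H s : X \in unitmx -> pairing X (G + s *: invmx X) H = pairing X G H.
Proof. by move=> uX; rewrite pairingD pairingZ pairing_inv // mulr0 addr0. Qed.

Lemma bracket_funE f g x F1 F2 G1 G2 :
  transvection_gradient f x F1 F2 -> transvection_gradient g x G1 G2 ->
  bracket_fun f g x = - 2^-1 * (pairing (X1 x) F1 G1 + pairing (X2 x) F2 G2).
Proof.
move=> dF dG; congr (_ * _).
have [s1 [s2 [-> ->]]] := transvection_gradient_unique (gradient_transvection
  (is_gradient_grad f x)) dF.
have [r1 [r2 [-> ->]]] := transvection_gradient_unique (gradient_transvection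
  (is_gradient_grad g x)) dG.
have [u1 u2] := (SL3_unit x.1, SL3_unit x.2).
rewrite !pairing_shift // ![pairing _ F1 _]pairingC ![pairing _ F2 _]pairingC.
by rewrite !pairing_shift.
Qed.

Lemma transvection_gradient_conj f x F1 F2 (c : SL3 K) : transvection_gradient f x F1 F2 ->
  transvection_gradient f (SL3_conj c x.1, SL3_conj c x.2)
    (val c *m F1 *m invmx (val c)) (val c *m F2 *m invmx (val c)).
Proof.
move=> dF u v vu; set P := val c; have uP : P \in unitmx := SL3_unit c.
have vu' : (v *m P) *m (invmx P *m u) = 0 by rewrite mulmxA mulmxK.
have moveP (y : SL3 K) t : SL3_mul (transvection t vu) (SL3_conj c y) =
    SL3_conj c (SL3_mul (transvection t vu') y).
  apply: val_inj => /=; rewrite -/P !mulmxDl !mulmxDr !mul1mx !mulmxDl.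
  congr (_ + _); rewrite -!scalemxAl -!scalemxAr -!scalemxAl !mulmxA.
  by rewrite mulmxV // mul1mx.
have trP (X G : 'M[K]_3) : \tr (u *m v *m (P *m X *m invmx P *m (P *m G *m invmx P)))
    = \tr (invmx P *m u *m (v *m P) *m (X *m G)).
  by rewrite !mulmxA mulmxKV // mxtrace_mulC !mulmxA.
have [[r rE r1] [s sE s1]] := dF _ _ vu'; split.
- exists r; last by rewrite r1 trP.
  by move=> t; rewrite /= moveP (coord_ring_conj f c (_, _)) rE.
- exists s; last by rewrite s1 trP.
  by move=> t; rewrite /= moveP (coord_ring_conj f c (_, _)) sE.
Qed.

Lemma bracket_fun_inv f g : bracket_fun f g \in @inv_regular K.
Proof.
have [r1 r2 _] := gradP f; have [s1 s2 _] := gradP g.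
apply/inv_regularP; split=> [|c x].
  have rX1 : regular_mx (@X1 K) by have [] := @reg_equivariant_X1 K.
  have rX2 : regular_mx (@X2 K) by have [] := @reg_equivariant_X2 K.
  have rP (X G H : pt -> 'M[K]_3) : regular_mx X -> regular_mx G -> regular_mx H ->
      regular_fun (fun x => pairing (X x) (G x) (H x)).
    move=> rX rG rH; apply: (@regular_ext _ (fun x =>
      \tr (X x *m X x *m (G x *m H x + (-1) *: (H x *m G x))))) => [x|].
      by rewrite scaleN1r.
    apply: regular_mxtrace; do ?[apply: regular_mxM | apply: regular_mxD] => //.
    by apply: regular_mxZ; [apply: regular_cst | apply: regular_mxM].
  apply: regularM; first exact: regular_cst.
  by apply: regularD; apply: rP.
have dF := gradient_transvection (is_gradient_grad f x); have dG := gradient_transvection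
  (is_gradient_grad g x).
rewrite (bracket_funE (transvection_gradient_conj c dF) (transvection_gradient_conj c dG)).
by rewrite !pairing_conj ?SL3_unit.
Qed.

Definition bracket f g : A := CoordRing (bracket_fun_inv f g).

Lemma bracketE f g x F1 F2 G1 G2 :
  transvection_gradient f x F1 F2 -> transvection_gradient g x G1 G2 ->
  bracket f g x = - 2^-1 * (pairing (X1 x) F1 G1 + pairing (X2 x) F2 G2).
Proof. exact: bracket_funE. Qed.

Lemma bracketC f g : bracket g f = - bracket f g.
Proof.
apply/crP => x; rewrite crN /= /bracket_fun.
by rewrite (pairingC (X1 x) ((grad f).1 x)) (pairingC (X2 x) ((grad f).2 x)); ring.
Qed.

Lemma bracketDl (a : K) f g h : bracket (a *: f + g) h = a *: bracket f h + bracket g h.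
Proof.
apply/crP => x; rewrite crD crZ.
have [[df dg] dh] := (is_gradient_grad f x, is_gradient_grad g x, is_gradient_grad h x).
have dc := @is_gradient_cst K a x.
have d := is_gradientD (is_gradientM dc df) dg.
rewrite (@bracketE (a *: f + g) h x _ _ _ _ (gradient_transvection d) (gradient_transvection
  dh)).
rewrite /= /bracket_fun !scaler0 !addr0 !pairingD !pairingZ; ring.
Qed.

Lemma bracketMl f g h : bracket (f * g) h = f * bracket g h + bracket f h * g.
Proof.
apply/crP => x; rewrite crD !crM.
have [[df dg] dh] := (is_gradient_grad f x, is_gradient_grad g x, is_gradient_grad h x).
rewrite (@bracketE (f * g) h x _ _ _ _ (gradient_transvection (is_gradientM df dg))
  (gradient_transvection dh)).
rewrite /= /bracket_fun !pairingD !pairingZ; ring.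
Qed.

End Bracket.

(** * Boundary traces and the value on t_(4) and t_(-4) *)

Section Casimirs.
Variable K : closedFieldType.
Hypothesis char_gt3 : 6 != 0 :> K.
Local Notation A := (coord_ring K).
Local Notation pt := (SL3 K * SL3 K)%type.
Local Notation V1 x := (invmx (X1 x)).
Local Notation V2 x := (invmx (X2 x)).
Implicit Types (f g h : A) (x y : pt) (u : 'cV[K]_3) (v : 'rV[K]_3).

Lemma affine_gradient f x (G1 G2 : 'M[K]_3) :
  (forall u v (vu : v *m u = 0) t, f (SL3_mul (transvection t vu) x.1, x.2)
     = f x + t * \tr (u *m v *m (X1 x *m G1))) ->
  (forall u v (vu : v *m u = 0) t, f (x.1, SL3_mul (transvection t vu) x.2)
     = f x + t * \tr (u *m v *m (X2 x *m G2))) ->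
  transvection_gradient f x G1 G2.
Proof.
move=> E1 E2 u v vu; split; [rewrite -[\tr _]mul1r | rewrite -[\tr _]mul1r].
- set k := \tr _; exists ((f x)%:P + k *: 'X) => [t|].
    by rewrite E1 hornerD hornerC hornerZ hornerX mulrC.
  by rewrite derivD derivC derivZ derivX add0r hornerZ hornerC mulr1 mul1r.
- set k := \tr _; exists ((f x)%:P + k *: 'X) => [t|].
    by rewrite E2 hornerD hornerC hornerZ hornerX mulrC.
  by rewrite derivD derivC derivZ derivX add0r hornerZ hornerC mulr1 mul1r.
Qed.

Lemma tr_transvection (W M : 'M[K]_3) t :
  \tr ((1%:M + t *: W) *m M) = \tr M + t * \tr (W *m M).
Proof. by rewrite mulmxDl mul1mx -scalemxAl mxtraceD mxtraceZ. Qed.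

(** The inverse of a transvection is a transvection, so traces of words with
    inverses are affine along these curves as well. *)
Lemma tr_transvectionV (W M : 'M[K]_3) t :
  \tr (M *m (1%:M - t *: W)) = \tr M + t * \tr (W *m - M).
Proof.
rewrite mulmxBr mulmx1 -scalemxAr raddfB /= mxtraceZ mxtrace_mulC mulmxN raddfN /=.
by rewrite mulrN.
Qed.

Lemma val_transvection_mul t u v (vu : v *m u = 0) (y : SL3 K) :
  val (SL3_mul (transvection t vu) y) = (1%:M + t *: (u *m v)) *m val y.
Proof. by []. Qed.

Lemma inv_transvection_mul t u v (vu : v *m u = 0) (y : SL3 K) :
  invmx (val (SL3_mul (transvection t vu) y)) = invmx (val y) *m (1%:M - t *: (u *m v)).
Proof.
by rewrite (_ : val _ = val (transvection t vu) *m val y) // invmxM ?SL3_det //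
  inv_transvection.
Qed.

Lemma same_trace (a : K) (t : K) (W X : 'M[K]_3) : a = a + t * \tr (W *m (X *m 0)).
Proof. by rewrite !mulmx0 mxtrace0 mulr0 addr0. Qed.

Local Notation T1 t vu x := (val (SL3_mul (transvection t vu) x.1)).
Local Notation T2 t vu x := (val (SL3_mul (transvection t vu) x.2)).

Lemma gradient_t1 x : transvection_gradient t1 x 1%:M 0.
Proof.
apply: affine_gradient => u v vu t; last exact: same_trace.
by rewrite -[LHS]/(\tr (T1 t vu x)) mulmx1 tr_transvection.
Qed.

Lemma gradient_t2 x : transvection_gradient t2 x 0 1%:M.
Proof.
apply: affine_gradient => u v vu t; first exact: same_trace.
by rewrite -[LHS]/(\tr (T2 t vu x)) mulmx1 tr_transvection.
Qed.

Lemma gradient_t1n x : transvection_gradient t1n x (- (V1 x *m V1 x)) 0.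
Proof.
apply: affine_gradient => u v vu t; last exact: same_trace.
rewrite -[LHS]/(\tr (invmx (T1 t vu x))) inv_transvection_mul.
by rewrite tr_transvectionV [_ *m - (_ *m _)]mulmxN mulKVmx ?SL3_unit.
Qed.

Lemma gradient_t2n x : transvection_gradient t2n x 0 (- (V2 x *m V2 x)).
Proof.
apply: affine_gradient => u v vu t; first exact: same_trace.
rewrite -[LHS]/(\tr (invmx (T2 t vu x))) inv_transvection_mul.
by rewrite tr_transvectionV [_ *m - (_ *m _)]mulmxN mulKVmx ?SL3_unit.
Qed.

Lemma gradient_t3 x : transvection_gradient t3 x (X2 x) (X1 x).
Proof.
apply: affine_gradient => u v vu t.
  by rewrite -[LHS]/(\tr (T1 t vu x *m X2 x)) val_transvection_mul -(mulmxA (1%:M + _))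
    tr_transvection.
rewrite -[LHS]/(\tr (X1 x *m T2 t vu x)) mxtrace_mulC val_transvection_mul -(mulmxA (1%:M +
  _)) tr_transvection.
by rewrite mxtrace_mulC.
Qed.

Lemma gradient_t3n x :
  transvection_gradient t3n x (- (V1 x *m V2 x *m V1 x)) (- (V2 x *m V1 x *m V2 x)).
Proof.
apply: affine_gradient => u v vu t.
  rewrite -[LHS]/(\tr (invmx (T1 t vu x) *m V2 x)) inv_transvection_mul.
  rewrite mxtrace_mulC (mulmxA (V2 x)) tr_transvectionV mxtrace_mulC.
  by rewrite [_ *m - (_ *m _ *m _)]mulmxN -[_ *m _ *m invmx _]mulmxA mulKVmx ?SL3_unit.
rewrite -[LHS]/(\tr (V1 x *m invmx (T2 t vu x))) inv_transvection_mul.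
rewrite (mulmxA (V1 x)) tr_transvectionV.
by rewrite [_ *m - (_ *m _ *m _)]mulmxN -[_ *m _ *m invmx _]mulmxA mulKVmx ?SL3_unit.
Qed.

Lemma gradient_t4 x : transvection_gradient t4 x (V2 x) (- (V2 x *m X1 x *m V2 x)).
Proof.
apply: affine_gradient => u v vu t.
  by rewrite -[LHS]/(\tr (T1 t vu x *m V2 x)) val_transvection_mul -(mulmxA (1%:M + _))
    tr_transvection.
rewrite -[LHS]/(\tr (X1 x *m invmx (T2 t vu x))) inv_transvection_mul.
rewrite (mulmxA (X1 x)) tr_transvectionV.
by rewrite [_ *m - (_ *m _ *m _)]mulmxN -[_ *m _ *m invmx _]mulmxA mulKVmx ?SL3_unit.
Qed.

Lemma gradient_t4n x : transvection_gradient t4n x (- (V1 x *m X2 x *m V1 x)) (V1 x).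
Proof.
apply: affine_gradient => u v vu t.
  rewrite -[LHS]/(\tr (invmx (T1 t vu x) *m X2 x)) inv_transvection_mul.
  rewrite mxtrace_mulC (mulmxA (X2 x)) tr_transvectionV mxtrace_mulC.
  by rewrite [_ *m - (_ *m _ *m _)]mulmxN -[_ *m _ *m invmx _]mulmxA mulKVmx ?SL3_unit.
rewrite -[LHS]/(\tr (V1 x *m T2 t vu x)) mxtrace_mulC val_transvection_mul -(mulmxA (1%:M +
  _)) tr_transvection.
by rewrite mxtrace_mulC.
Qed.

Lemma tr_commutator (Y X G : 'M[K]_3) :
  \tr (Y *m (X *m G - G *m X)) = \tr ((Y *m X - X *m Y) *m G).
Proof.
rewrite mulmxBr mulmxBl !raddfB /= !mulmxA; congr (_ - _).
by rewrite [LHS]mxtrace_mulC mulmxA.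
Qed.

(** Differentiating the constant function f along conjugation by transvections
    gives tr (W S) = 0 for all nilpotent W of rank one, where S is the left-hand
    side; so S is scalar, and its trace is zero. *)
Lemma infinitesimal_invariance f x G1 G2 : is_gradient f x G1 G2 ->
  X1 x *m G1 - G1 *m X1 x + (X2 x *m G2 - G2 *m X2 x) = 0.
Proof.
move=> df; set S := LHS.
(* Conjugation by 1 + t W, with inverse 1 - t W, is a polynomial curve. *)
have [u v vu|s sE] := @scalar_mx_transvection K S.
  set W := u *m v.
  pose c t := (SL3_conj (transvection t vu) x.1, SL3_conj (transvection t vu) x.2).
  pose cur X := line W *m map_mx polyC X *m line (- W).
  have c0 : c 0 = x.
    rewrite /c; case: (x) => a b; congr (_, _); apply: val_inj;
      by rewrite /= -[1%:M + _]/(val (transvection 0 vu)) inv_transvection /=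
        !scale0r subr0 addr0 mul1mx mulmx1.
  have pc : poly_curve c (cur (X1 x)) (cur (X2 x)).
    by move=> t; split; rewrite !mx_atM !mx_at_line mx_at_const /= -[X in _ *m invmx X]/(val
      (transvection t vu)) inv_transvection scalerN.
  have [r rE] := df _ _ _ c0 pc.
  have -> : r = (f x)%:P.
    by apply: poly_ext => t; rewrite -rE hornerC (coord_ring_conj f _ x).
  have velE X : velocity (cur X) = W *m X - X *m W.
    rewrite !velocityM !velocity_line !velocity_const mulmx0 addr0 !mx_at_const.
    by rewrite mx_atM !mx_at_line mx_at_const !scale0r !addr0 mulmx1 mul1mx mulmxN.
  rewrite derivC horner0 !velE => ->; rewrite /S.
  by rewrite mulmxDr mxtraceD !tr_commutator.
have trS : \tr S = 0.
  by rewrite mxtraceD !raddfB /= !(mxtrace_mulC (X1 x)) !(mxtrace_mulC (X2 x)) !subrr addr0.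
move: trS; rewrite sE mxtrace_scalar => /eqP; rewrite -mulr_natr mulf_eq0.
by rewrite (negPf (three_neq0 char_gt3)) orbF => /eqP->; apply/matrixP=> i j; rewrite !mxE
  mul0rn.
Qed.


Lemma pairing_comm (X G H : 'M[K]_3) :
  pairing X G H = \tr ((X *m X *m G - G *m X *m X) *m H).
Proof.
rewrite /pairing mulmxBr mulmxBl !raddfB /= !mulmxA; congr (_ - _).
by rewrite [LHS]mxtrace_mulC !mulmxA.
Qed.

(** The hypotheses say that [X_i^2, F_i] = [Y, X_i] for both factors; then the
    bracket of f with g is a multiple of tr (Y S), where S is the matrix in
    [infinitesimal_invariance] for g. *)
Lemma bracket_casimir f x F1 F2 Y : transvection_gradient f x F1 F2 ->
  X1 x *m X1 x *m F1 - F1 *m X1 x *m X1 x = Y *m X1 x - X1 x *m Y ->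
  X2 x *m X2 x *m F2 - F2 *m X2 x *m X2 x = Y *m X2 x - X2 x *m Y ->
  forall g, bracket f g x = 0.
Proof.
move=> dF e1 e2 g; have dG := @is_gradient_grad K g x.
rewrite (bracketE dF (gradient_transvection dG)) !pairing_comm e1 e2.
by rewrite -!tr_commutator -mxtraceD -mulmxDr (infinitesimal_invariance dG) mulmx0 mxtrace0
  mulr0.
Qed.

Lemma addrDB (M : zmodType) (a b c : M) : a + c - (b + c) = a - b.
Proof. by rewrite opprD addrACA subrr addr0. Qed.

Lemma bracket_boundary f g : f \in [:: t1; t1n; t2; t2n; t3; t3n] -> bracket f g = 0.
Proof.
move=> fin; apply: crP => x; rewrite cr0; move: fin; rewrite !inE.
have [u1 u2] : X1 x \in unitmx /\ X2 x \in unitmx by rewrite !SL3_unit.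
case/or4P => [/eqP->|/eqP->|/eqP->|].
- apply: (bracket_casimir (Y := 0) (gradient_t1 x));
    by rewrite ?mulmx1 ?mul1mx !mulmx0 !mul0mx ?subrr.
- apply: (bracket_casimir (Y := 0) (gradient_t1n x)).
    rewrite mulmxN !mulNmx -(mulmxA (X1 x)) mulKVmx // mulmxKV // mulVmx // mulmxV //.
    by rewrite mul0mx mulmx0 !subrr.
  by rewrite !mulmx0 !mul0mx.
- apply: (bracket_casimir (Y := 0) (gradient_t2 x));
    by rewrite ?mulmx1 ?mul1mx !mulmx0 !mul0mx ?subrr.
case/or3P => [/eqP->|/eqP->|/eqP->].
- apply: (bracket_casimir (Y := 0) (gradient_t2n x)).
    by rewrite !mulmx0 !mul0mx.
  rewrite mulmxN !mulNmx -(mulmxA (X2 x)) mulKVmx // mulmxKV // mulVmx // mulmxV //.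
  by rewrite mul0mx mulmx0 !subrr.
- apply: (bracket_casimir (Y := - (X1 x *m X2 x + X2 x *m X1 x)) (gradient_t3 x)).
    rewrite mulNmx mulmxN opprK mulmxDl mulmxDr !mulmxA [RHS]addrC.
    by rewrite [X in _ = _ - X]addrC addrDB.
  rewrite mulNmx mulmxN opprK mulmxDl mulmxDr !mulmxA [RHS]addrC.
  by rewrite [X in _ = X - _]addrC addrDB.
- apply: (bracket_casimir (Y := V2 x *m V1 x + V1 x *m V2 x) (gradient_t3n x)).
    rewrite mulmxDl mulmxDr !mulmxN !mulNmx !mulmxA mulmxK // !mulmxKV //.
    by rewrite mulmxV // mul1mx [X in _ = X - _]addrC addrDB opprK addrC.
  rewrite mulmxDl mulmxDr !mulmxN !mulNmx !mulmxA mulmxK // !mulmxKV //.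
  by rewrite mulmxV // mul1mx [X in _ = _ - X]addrC addrDB opprK addrC.
Qed.

Lemma bracket_t4_t4n : bracket t4 t4n = t5n - t5 :> A.
Proof.
apply: crP => x; rewrite crD crN (bracketE (gradient_t4 x) (gradient_t4n x)).
have [u1 u2] : X1 x \in unitmx /\ X2 x \in unitmx by rewrite !SL3_unit.
have e1 : pairing (X1 x) (V2 x) (- (V1 x *m X2 x *m V1 x)) = t5 x - t5n x.
  rewrite pairing_comm mulmxN raddfN /= mulmxBl raddfB /= opprB !mulmxA mulmxK //.
  congr (_ - _).
    by rewrite -!mulmxA mxtrace_mulC !mulmxA.
  rewrite mxtrace_mulC !mulmxA mulVmx // mul1mx.
  by rewrite [LHS]mxtrace_mulC !mulmxA.
have e2 : pairing (X2 x) (- (V2 x *m X1 x *m V2 x)) (V1 x) = t5 x - t5n x.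
  rewrite pairing_comm mulmxN !mulNmx opprK addrC !mulmxA mulmxK // mulmxKV // mulmxBl raddfB
    /=.
  congr (_ - _).
  by rewrite -!mulmxA mxtrace_mulC !mulmxA.
rewrite e1 e2; field; exact: two_neq0.
Qed.

End Casimirs.

(** * Jacobi identity and uniqueness *)

Section Poisson.
Variable K : closedFieldType.
Hypothesis char_gt3 : 6 != 0 :> K.
Local Notation A := (coord_ring K).
Implicit Types (f g h : A) (br : A -> A -> A).

Definition boundary : seq A := [:: t1; t1n; t2; t2n; t3; t3n].
Definition coordinates : seq A := [:: t1; t1n; t2; t2n; t3; t3n; t4; t4n].

Lemma coordinatesP f : f \in coordinates -> f \in boundary \/ f \in [:: t4; t4n].
Proof.
rewrite -[coordinates]/(boundary ++ [:: t4; t4n]) mem_cat => /orP[]; by [left|right].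
Qed.

Lemma derivation_eq0 (D : A -> A) : derivation D ->
  (forall t, t \in coordinates -> D t = 0) -> forall f, D f = 0.
Proof. by move=> dD Dt; apply: (derivation_rigidity char_gt3 dD) => t /Dt/eqP. Qed.

Lemma biderivation_eq0 br : (forall f, derivation (br f)) ->
  (forall g, derivation (br^~ g)) ->
  (forall s t, s \in coordinates -> t \in coordinates -> br s t = 0) ->
  forall f g, br f g = 0.
Proof.
move=> dr dl st f g; apply: (derivation_eq0 (dl g)) => s cs.
by apply: (derivation_eq0 (dr s)) => t; apply: st.
Qed.

Lemma lie_skew br : lie_bracket br -> forall f g, br g f = - br f g.
Proof.
move=> [Dl Dr alt _] f g; have := alt (f + g).
rewrite -[f]scale1r Dl !Dr !scale1r !alt !addr0 add0r addrC => h.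
by apply/eqP; rewrite -addr_eq0 h.
Qed.

Lemma derivationB (D E : A -> A) : derivation D -> derivation E ->
  derivation (fun f => D f - E f).
Proof.
move=> [Dl DM] [El EM]; split=> [a f g|f g]; last by rewrite DM EM; ring.
by rewrite Dl El scalerBr opprD addrACA.
Qed.

Lemma poisson_derr br : poisson_bracket br -> forall f, derivation (br f).
Proof. by move=> [[_ Dr _ _] _ Mr] f; split=> [a g h|g h]; [exact: Dr|exact: Mr]. Qed.

Lemma poisson_derl br : poisson_bracket br -> forall g, derivation (br^~ g).
Proof. by move=> [[Dl _ _ _] Ml _] f; split=> [a g h|g h]; [exact: Dl|exact: Ml]. Qed.

(** By skew symmetry and the Casimir condition, the brackets of all pairs among the
    eight traces are determined by that of t_(4) and t_(-4). *)
Lemma poisson_unique br br' : poisson_bracket br -> poisson_bracket br' ->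
  (forall c, c \in boundary -> casimir br c) ->
  (forall c, c \in boundary -> casimir br' c) ->
  br t4 t4n = br' t4 t4n -> br = br'.
Proof.
move=> pb pb' cb cb' e; apply/funext => f; apply/funext => g; apply/subr0_eq.
have [lb _ _] := pb; have [lb' _ _] := pb'.
have sk := lie_skew lb; have sk' := lie_skew lb'.
apply: (@biderivation_eq0 (fun f g => br f g - br' f g)).
- by move=> h; apply: derivationB; apply: poisson_derr.
- by move=> h; apply: derivationB; apply: poisson_derl.
move=> s t /coordinatesP[cs|cs]; first by rewrite cb // cb' // subrr.
move=> /coordinatesP[ct|ct]; first by rewrite sk sk' cb // cb' // subrr.
have [[_ _ alt _] [_ _ alt' _]] := (lb, lb').
move: cs ct; rewrite !inE => /orP[]/eqP-> /orP[]/eqP->; rewrite ?alt ?alt' ?subrr //.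
  by rewrite e subrr.
by rewrite (sk t4) (sk' t4) e subrr.
Qed.

Section Jacobi.
Variable br : A -> A -> A.
Hypothesis derl : forall g, derivation (br^~ g).
Hypothesis skew : forall f g, br g f = - br f g.
Hypothesis alt : forall f, br f f = 0.
Hypothesis cas : forall c, c \in boundary -> casimir br c.

Let derr f : derivation (br f).
Proof.
split=> [a g h|g h]; rewrite !(skew _ f).
  by rewrite (derl f).1 opprD scalerN.
by rewrite (derl f).2; ring.
Qed.

(** For a skew biderivation this is a derivation in each argument, so it is
    determined by its values on the eight traces. *)
Definition jacobiator f g h := br f (br g h) + br g (br h f) + br h (br f g).

Lemma jacobiator_der f g : derivation (jacobiator f g).
Proof.
have Nr u v : br u (- v) = - br u v by rewrite (derDN (derr u)).
have Ar u v w : br u (v + w) = br u v + br u w by rewrite (derD_add (derr u)).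
split=> [a u v|u v]; rewrite /jacobiator.
  rewrite (derr g).1 (derr f).1 (derl f).1 (derr g).1 (derl (br f g)).1.
  by rewrite !scalerDr; ring.
rewrite (derr g).2 Ar !(derr f).2 (derl f).2 Ar !(derr g).2 (derl (br f g)).2.
by rewrite !(skew f) !Nr; ring.
Qed.

Lemma jacobiator_cycle f g h : jacobiator f g h = jacobiator g h f.
Proof. by rewrite /jacobiator; ring. Qed.

Lemma jacobiator_boundary c f g : c \in boundary -> jacobiator c f g = 0.
Proof.
move=> /cas cc; rewrite /jacobiator !cc (skew c g) cc oppr0.
by rewrite !(derD0 (derr _)) !addr0.
Qed.

Lemma jacobiator_alt f g : jacobiator f f g = 0.
Proof.
rewrite /jacobiator alt (derD0 (derr _)) addr0 (skew f g) (derDN (derr _)).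
by rewrite subrr.
Qed.

(** Two of three elements of {t_(4), t_(-4)} coincide. *)
Lemma jacobiator_coordinates r s t :
  r \in coordinates -> s \in coordinates -> t \in coordinates -> jacobiator r s t = 0.
Proof.
move=> /coordinatesP[/jacobiator_boundary->//|cr].
move=> /coordinatesP[|cs]; first by move=> /jacobiator_boundary; rewrite jacobiator_cycle => ->.
move=> /coordinatesP[|ct].
  by move=> /jacobiator_boundary; rewrite -jacobiator_cycle => ->.
move: cr cs ct; rewrite !inE.
case/orP=> /eqP-> /orP[]/eqP-> /orP[]/eqP->; rewrite ?jacobiator_alt //;
 by rewrite jacobiator_cycle ?jacobiator_alt // jacobiator_cycle jacobiator_alt.
Qed.

Lemma jacobi f g h : jacobiator f g h = 0.
Proof.
apply: (derivation_eq0 (jacobiator_der f g)) => t ct; rewrite -jacobiator_cycle.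
apply: (derivation_eq0 (jacobiator_der t f)) => s cs; rewrite -jacobiator_cycle.
apply: (derivation_eq0 (jacobiator_der s t)) => r cr.
exact: jacobiator_coordinates.
Qed.

End Jacobi.

Lemma bracket_poisson : poisson_bracket (@bracket K).
Proof.
have alt f : bracket f f = 0.
  apply: crP => x; rewrite /= /bracket_fun /pairing !subrr !mulmx0 !mxtrace0.
  by rewrite addr0 mulr0.
have dl g : derivation (fun f => bracket f g).
  by split=> *; [exact: bracketDl | exact: bracketMl].
have sk f g : bracket g f = - bracket f g by exact: bracketC.
split=> [|f g h|f g h]; last by rewrite !(sk _ h) bracketMl; ring.
- split=> [a f g h|a f g h|//|f g h]; first exact: bracketDl.
    by rewrite !(sk _ h) bracketDl opprD scalerN.
  apply: (jacobi dl sk alt) => c bc g'; exact: bracket_boundary.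
- exact: bracketMl.
Qed.

(** Bracketing with the relation of t_(5) gives
    (2 t_(5) - P) {f, t_(5)} = t_(5) {f, P} - {f, Q}. *)
Lemma poisson_bracket_t5 br f : poisson_bracket br -> br t4 t4n = polP - 2 * t5 ->
  tofrac (br f t5) = tofrac (t5 * br f polP - br f polQ) / tofrac (br t4n t4).
Proof.
move=> pb e; have [lb _ _] := pb.
have gapE : br t4n t4 = 2 * t5 - polP by rewrite (lie_skew lb) e opprB.
have nz : tofrac (br t4n t4) != 0 by rewrite tofrac_eq0 gapE comm_gap_neq0.
apply: (canRL (mulfK nz)); rewrite -tofracM gapE; congr tofrac.
have dD := poisson_derr pb f.
have := t5_quadratic char_gt3; move: polP polQ t5 => p q t rel.
have := congr1 (br f) rel; rewrite (derD0 dD) expr2 !(derD_add dD) (derDN dD) !dD.2 => h.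
by apply/eqP; rewrite -subr_eq0 -h; apply/eqP; ring.
Qed.

End Poisson.

Theorem theorem4p3p1 (R : realType) :
  exists! br : coord_ring R[i] -> coord_ring R[i] -> coord_ring R[i],
    [/\ poisson_bracket br,
        forall c : coord_ring R[i],
          c \in [:: t1; t1n; t2; t2n; t3; t3n] -> casimir br c,
        br t4 t4n = polP - 2 * t5
      & forall u : coord_ring R[i], u \in [:: t4; t4n] ->
          tofrac (br u t5) =
            tofrac (t5 * br u polP - br u polQ) / tofrac (br t4n t4)].
Proof.
have h6 : 6 != 0 :> R[i] by rewrite pnatr_eq0.
have pb := bracket_poisson h6.
have cb c : c \in boundary R[i] -> casimir (@bracket R[i]) c.
  by move=> bc g; apply: bracket_boundary.
have e : bracket t4 t4n = polP - 2 * t5 :> coord_ring R[i].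
  by rewrite (bracket_t4_t4n h6) (comm_sum h6); ring.
exists (@bracket R[i]); split.
  by split=> // u _; apply: poisson_bracket_t5.
move=> br [pb' cb' e' _]; apply: poisson_unique => //.
by rewrite e e'.
Qed.
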